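(* Let $s\in(0,1)$, $N\ge1$, $m>-1$, and $\gamma\ge0$. Assume that $\mathbf{w}\in L^1_{\mathrm{loc}}([0,\infty)\times\mathbb{R}^N)$, $\mathbf{w}\ge0$, satisfies $$\int_{|x|\le R}\mathbf{w}(x,t)\,dx\ge c_0\,t^mR^\gamma\qquad\text{for all }t\ge1,\ R\ge1,$$ for some constant $c_0>0$. Then the problem $$\partial_tu+(-\Delta)^su=|u|^p+\mathbf{w}(x,t)\ \text{ in }(0,\infty)\times\mathbb{R}^N,\qquad u(0,\cdot)=u_0\ge0,$$ admits no global weak solution for $$1<p<p_F^{\,s}(\gamma,m):=\frac{N-\gamma-2sm}{N-\gamma-2sm-2s},$$ with the convention that $p_F^{\,s}(\gamma,m)=\infty$ whenever $N-\gamma-2sm\le2s$. In particular, if $N-\gamma-2sm\le2s$, then nonexistence holds for every $p>1$.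
   Context: $(-\Delta)^s$ is the fractional Laplacian (Fourier multiplier $|\xi|^{2s}$). Global weak solution: let $p>1$, $u_0\in L^1_{\mathrm{loc}}(\mathbb{R}^N)$, $u_0\ge0$. A global weak solution is a function $u\in L^p_{\mathrm{loc}}([0,\infty)\times\mathbb{R}^N)$, $u\ge0$ a.e., with $u\,(1+|x|)^{-(N+2s)}\in L^1((0,T)\times\mathbb{R}^N)$ for every $T>0$, such that $$\int_0^T\!\!\int_{\mathbb{R}^N}(|u|^p+\mathbf{w})\varphi\,dx\,dt+\int_{\mathbb{R}^N}u_0\,\varphi(0,x)\,dx=-\int_0^T\!\!\int_{\mathbb{R}^N}u\,\partial_t\varphi\,dx\,dt+\int_0^T\!\!\int_{\mathbb{R}^N}u\,(-\Delta)^s\varphi\,dx\,dt$$ for every $T>0$ and every admissible $\varphi$, that is: every nonnegative $\varphi\in C^{1,2}([0,T]\times\mathbb{R}^N)$ (once continuously differentiable in time, twice in space), compactly supported in space, with $\varphi(T,\cdot)\equiv0$, and in addition smooth so that $(-\Delta)^s\varphi$ is defined and integrable. ''Admits no global weak solution'' means that none exists for any such $u_0$. *)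

(* Defs.v *)
From HB Require Import structures.
From mathcomp Require Import all_boot all_order all_algebra.
From mathcomp Require Import all_classical all_reals all_analysis.
From mathcomp Require Import complex.

Set Implicit Arguments.
Unset Strict Implicit.
Unset Printing Implicit Defensive.
Import Order.TTheory GRing.Theory Num.Theory.
Import numFieldNormedType.Exports.

Local Open Scope classical_set_scope.
Local Open Scope ring_scope.

(* R^n is 'rV[R]_n with its library topology. It carries the sigma-algebra
   generated by the coordinates, that is, the Borel one; elements of L^1_loc
   and L^p_loc are given by Borel representatives. *)
Definition rV_coord (R : realType) (n : nat) (i : 'I_n) (x : 'rV[R]_n) :
  measurableTypeR R := x ord0 i.

Fact rV_measurable0 (R : realType) (n : nat) :
  g_sigma_preimage (@rV_coord R n) set0.
Proof. exact: sigma_algebra0. Qed.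

Fact rV_measurableC (R : realType) (n : nat) (A : set 'rV[R]_n) :
  g_sigma_preimage (@rV_coord R n) A -> g_sigma_preimage (@rV_coord R n) (~` A).
Proof. exact: sigma_algebraC. Qed.

Fact rV_measurable_bigcup (R : realType) (n : nat) (F : (set 'rV[R]_n)^nat) :
  (forall i, g_sigma_preimage (@rV_coord R n) (F i)) ->
  g_sigma_preimage (@rV_coord R n) (\bigcup_i F i).
Proof. exact: sigma_algebra_bigcup. Qed.

Definition rV_display : measure_display.
Proof. exact: (measure_tuple_display default_measure_display). Qed.

HB.instance Definition _ (R : realType) (n : nat) :=
  @isMeasurable.Build rV_display 'rV[R]_n (g_sigma_preimage (@rV_coord R n))
    (@rV_measurable0 R n) (@rV_measurableC R n) (@rV_measurable_bigcup R n).

Lemma measurable_rV_coord (R : realType) (n : nat) (i : 'I_n) :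
  measurable_fun [set: 'rV[R]_n] (@rV_coord R n i).
Proof.
move=> _ Y mY; rewrite setTI; apply: sub_sigma_algebra => /=.
rewrite -bigcup_seq/=; exists i => /=; first by rewrite mem_index_enum.
by exists Y => //; rewrite setTI.
Qed.

Lemma measurable_fun_rVP d (T : measurableType d) (R : realType) (n : nat)
    (f : T -> 'rV[R]_n) :
  (forall i, measurable_fun [set: T] (@rV_coord R n i \o f)) ->
  measurable_fun [set: T] f.
Proof.
move=> mf _ A mA; rewrite setTI.
have : preimage_set_system setT f (g_sigma_preimage (@rV_coord R n))
    `<=` measurable.
  rewrite /g_sigma_preimage -g_sigma_preimageE.
  apply: smallest_sub; first exact: sigma_algebra_measurable.
  move=> B [C]; rewrite -bigcup_seq => -[i _ [D mD <-]] <-.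
  by rewrite !setTI -[X in measurable X]setTI; exact: mf.
by apply; exists A => //; rewrite setTI.
Qed.

Definition rV_cons (R : realType) (n : nat) (z : R * 'rV[R]_n) : 'rV[R]_n.+1 :=
  row_mx (z.1)%:M z.2.

Lemma measurable_rV_cons (R : realType) (n : nat) :
  measurable_fun [set: measurableTypeR R * 'rV[R]_n] (@rV_cons R n).
Proof.
apply: measurable_fun_rVP => i.
case: (@split_ordP 1 n i) => j ->{i}.
- rewrite (_ : _ \o _ = fst); first exact: measurable_fst.
  apply/funext => z /=; rewrite /rV_coord /rV_cons.
  by rewrite (@row_mxEl _ 1 1 n) mxE; case: j => -[].
- rewrite (_ : _ \o _ = @rV_coord R n j \o snd).
    by apply: measurableT_comp => //; exact: measurable_rV_coord.
  by apply/funext => z /=; rewrite /rV_coord /rV_cons (@row_mxEr _ 1 1 n).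
Qed.

(* n-dimensional Lebesgue measure, as an iterated product. *)
Fixpoint leb (R : realType) (n : nat) : set 'rV[R]_n -> \bar R :=
  match n with
  | 0 => dirac (0 : 'rV[R]_0)
  | n'.+1 => pushforward (lebesgue_measure \x @leb R n')%E (@rV_cons R n')
  end.
Arguments leb R n : clear implicits.

Definition rV_uncons (R : realType) (n : nat) (x : 'rV[R]_n.+1) : R * 'rV[R]_n :=
  (x ord0 ord0, \row_i x ord0 (lift ord0 i)).

Lemma rV_consK (R : realType) (n : nat) : cancel (@rV_cons R n) (@rV_uncons R n).
Proof.
move=> [a v]; rewrite /rV_cons /rV_uncons; congr pair.
  transitivity (row_mx a%:M v ord0 (@lshift 1 n ord0)).
    by congr (row_mx _ _ _ _); exact: ord_inj.
  by rewrite row_mxEl mxE.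
apply/rowP => i; rewrite mxE.
transitivity (row_mx a%:M v ord0 (@rshift 1 n i)).
  by congr (row_mx _ _ _ _); exact: ord_inj.
by rewrite row_mxEr.
Qed.

Lemma rV_unconsK (R : realType) (n : nat) : cancel (@rV_uncons R n) (@rV_cons R n).
Proof.
move=> x; apply/rowP => i; rewrite /rV_cons /rV_uncons /=.
case: (@split_ordP 1 n i) => j ->{i}.
  rewrite (@row_mxEl _ 1 1 n) mxE; case: j => -[]// j0 /=.
  by congr (x _ _); exact: ord_inj.
by rewrite (@row_mxEr _ 1 1 n) mxE; congr (x _ _); exact: ord_inj.
Qed.

Lemma measurable_rV_uncons (R : realType) (n : nat) :
  measurable_fun [set: 'rV[R]_n.+1]
    (@rV_uncons R n : _ -> measurableTypeR R * 'rV[R]_n).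
Proof.
apply/measurable_fun_pairP; split; first exact: (measurable_rV_coord ord0).
apply: measurable_fun_rVP => i.
rewrite (_ : _ \o _ = @rV_coord R n.+1 (lift ord0 i)).
  exact: measurable_rV_coord.
by apply/funext => x; rewrite /rV_coord /= mxE.
Qed.

Lemma sigma_finite_prod d1 d2 (T1 : measurableType d1) (T2 : measurableType d2)
    (R : realType) (m1 : {sigma_finite_measure set T1 -> \bar R})
    (m2 : {sigma_finite_measure set T2 -> \bar R}) :
  sigma_finite [set: T1 * T2] (m1 \x m2)%E.
Proof.
have /sigma_finiteP[F [TF ndF Foo]] := sigma_finiteT m1.
have /sigma_finiteP[G [TG ndG Goo]] := sigma_finiteT m2.
exists (fun n => F n `*` G n).
  rewrite -setXTT TF TG predeqE => -[x y]; split.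
    move=> [/= [n _ Fnx] [k _ Gky]]; exists (maxn n k) => //; split.
    - by move: x Fnx; exact/subsetPset/ndF/leq_maxl.
    - by move: y Gky; exact/subsetPset/ndG/leq_maxr.
  by move=> [n _ []/= ? ?]; split; exists n.
move=> k; have [? ?] := Foo k; have [? ?] := Goo k.
split; first exact: measurableX.
by rewrite product_measure1E// lte_mul_pinfty// ge0_fin_numE.
Qed.

Lemma bundle_sigma_finite_measure d (T : measurableType d) (R : realType)
    (q : set T -> \bar R) (q0 : q set0 = 0%E) (q_ge0 : forall A, (0 <= q A)%E)
    (q_additive : semi_sigma_additive q) (q_sigma : sigma_finite setT q) :
  exists mu : {sigma_finite_measure set T -> \bar R},
    mu = q :> (set T -> \bar R).
Proof.
pose qm := isMeasure.Build _ _ _ q q0 q_ge0 q_additive.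
pose Q : {measure set T -> \bar R} := HB.pack q qm.
pose qs := @Measure_isSigmaFinite.Build _ _ _ Q q_sigma.
by exists (HB.pack q qm qs : {sigma_finite_measure set T -> \bar R}).
Qed.

Lemma leb_sigma_finite_measure (R : realType) (n : nat) :
  exists mu : {sigma_finite_measure set 'rV[R]_n -> \bar R},
    mu = leb R n :> (set 'rV[R]_n -> \bar R).
Proof.
elim: n => [|n [mu IH]] /=.
  by exists (dirac (0 : 'rV[R]_0)).
rewrite -IH.
pose p : {measure set _ -> \bar R} := (@lebesgue_measure R \x mu)%E.
have mc := @measurable_rV_cons R n.
have pre A : measurable A -> measurable (@rV_cons R n @^-1` A).
  by move=> mA; rewrite -[X in measurable X]setTI; exact: mc.
pose q := pushforward p (@rV_cons R n).
have q0 : q set0 = 0%E by exact: (@measure0 _ _ _ p).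
have q_ge0 A : (0 <= q A)%E by exact: (@measure_ge0 _ _ _ p).
have q_additive : semi_sigma_additive q.
  move=> F mF tF mUF; rewrite /q /pushforward preimage_bigcup.
  apply: (@measure_semi_sigma_additive _ _ _ p) => //.
  - by move=> k; exact: pre.
  - apply/trivIsetP => /= i j _ _ ij; rewrite -preimage_setI.
    by move/trivIsetP : tF => /(_ _ _ _ _ ij) ->//; rewrite preimage_set0.
  - by rewrite -preimage_bigcup; exact: pre.
have q_sigma : sigma_finite setT q.
  have [F FT Foo] := sigma_finite_prod (@lebesgue_measure R) mu.
  have cG := @rV_consK R n; have Gc := @rV_unconsK R n.
  pose G := @rV_uncons R n.
  exists (fun k => G @^-1` F k) => [|k].
    by rewrite -preimage_bigcup -FT preimage_setT.
  have [mF Fk] := Foo k.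
  split.
    by rewrite -[X in measurable X]setTI; exact: measurable_rV_uncons.
  rewrite /q /pushforward -comp_preimage (_ : G \o _ = id) ?preimage_id//.
  exact/funext.
exact: bundle_sigma_finite_measure.
Qed.

Fact leb0 (R : realType) (n : nat) : leb R n set0 = 0%E.
Proof. by have [mu <-] := leb_sigma_finite_measure R n; exact: measure0. Qed.

Fact leb_ge0 (R : realType) (n : nat) (A : set 'rV[R]_n) : (0 <= leb R n A)%E.
Proof. by have [mu <-] := leb_sigma_finite_measure R n; exact: measure_ge0. Qed.

Fact leb_semi_sigma_additive (R : realType) (n : nat) :
  semi_sigma_additive (leb R n).
Proof.
have [mu <-] := leb_sigma_finite_measure R n.
exact: measure_semi_sigma_additive.
Qed.

HB.instance Definition _ (R : realType) (n : nat) :=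
  isMeasure.Build _ _ _ (leb R n) (@leb0 R n) (@leb_ge0 R n)
    (@leb_semi_sigma_additive R n).

Fact leb_sigma_finite (R : realType) (n : nat) : sigma_finite setT (leb R n).
Proof. by have [mu <-] := leb_sigma_finite_measure R n; exact: sigma_finiteT. Qed.

HB.instance Definition _ (R : realType) (n : nat) :=
  Measure_isSigmaFinite.Build _ _ _ (leb R n) (@leb_sigma_finite R n).

(* Points of space-time are pairs (t, x). *)
Definition lebtx (R : realType) (n : nat) :
    set (measurableTypeR R * 'rV[R]_n) -> \bar R :=
  (lebesgue_measure \x leb R n)%E.
Arguments lebtx R n : clear implicits.

HB.instance Definition _ (R : realType) (n : nat) :=
  Measure.on (lebtx R n).

Fact lebtx_sigma_finite (R : realType) (n : nat) :
  sigma_finite setT (lebtx R n).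
Proof. exact: sigma_finite_prod. Qed.

HB.instance Definition _ (R : realType) (n : nat) :=
  Measure_isSigmaFinite.Build _ _ _ (lebtx R n) (@lebtx_sigma_finite R n).

Definition dot (R : realType) (n : nat) (x y : 'rV[R]_n) : R :=
  \sum_(i < n) x ord0 i * y ord0 i.

(* The Euclidean norm; the library norm `|x| on 'rV[R]_n is the sup norm. *)
Definition enorm (R : realType) (n : nat) (x : 'rV[R]_n) : R :=
  Num.sqrt (dot x x).

Definition eball (R : realType) (n : nat) (r : R) : set 'rV[R]_n :=
  [set x | enorm x <= r].
Arguments eball {R} n r.

Definition cyl (R : realType) (n : nat) (I : interval R) :
    set (R * 'rV[R]_n) := [set` I] `*` setT.
Arguments cyl {R} n I.

Definition L1loc (R : realType) (n : nat) (f : 'rV[R]_n -> R) : Prop :=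
  measurable_fun setT f /\
  forall K, compact K -> (\int[leb R n]_(x in K) `|f x|%:E < +oo)%E.

(* L^p_loc([0, oo) x R^n): compact subsets may touch t = 0. *)
Definition Lploctx (R : realType) (n : nat) (p : R) (f : R * 'rV[R]_n -> R) :
    Prop :=
  measurable_fun (cyl n `[0, +oo[) f /\
  forall K, K `<=` cyl n `[0, +oo[ -> compact K ->
    (\int[lebtx R n]_(z in K) (`|f z| `^ p)%:E < +oo)%E.

(* \hat f(xi) = \int f(x) e^{- i x.xi} dx, so that - Delta has symbol |xi|^2. *)
Definition fourier (R : realType) (n : nat) (f : 'rV[R]_n -> R)
    (xi : 'rV[R]_n) : R[i]%C :=
  ((\int[leb R n]_x (f x * cos (dot x xi)))
    -i* (\int[leb R n]_x (f x * sin (dot x xi))))%C.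

(* g = (- Delta)^s f as the Fourier multiplier |xi|^{2s}, for (- Delta)^s f
   integrable: g is then determined up to a null set, because the Fourier
   transform is injective on L^1. *)
Definition fraclap (R : realType) (n : nat) (s : R) (f g : 'rV[R]_n -> R) :
    Prop :=
  [/\ (leb R n).-integrable setT (EFin \o f),
      (leb R n).-integrable setT (EFin \o g) &
      forall xi, fourier g xi = ((enorm xi `^ (2 * s))%:C)%C * fourier f xi].

Definition dt (R : realType) (n : nat) (f : R * 'rV[R]_n -> R)
    (z : R * 'rV[R]_n) : R := derive1 (fun t => f (t, z.2)) z.1.

Definition dx (R : realType) (n : nat) (i : 'I_n) (f : R * 'rV[R]_n -> R)
    (z : R * 'rV[R]_n) : R := 'D_(delta_mx 0 i) (fun x => f (z.1, x)) z.2.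

Definition derivable_x (R : realType) (n : nat) (i : 'I_n)
    (f : R * 'rV[R]_n -> R) (z : R * 'rV[R]_n) : Prop :=
  derivable (fun x => f (z.1, x)) z.2 (delta_mx 0 i).

(* C^{1,2}([0, T] x R^n): the time derivative exists for 0 < t < T and extends
   continuously to the closed interval. *)
Definition C12 (R : realType) (n : nat) (T : R) (f : R * 'rV[R]_n -> R) :
    Prop :=
  let Q := cyl n `[0, T] in
  [/\ {within Q, continuous f},
      (exists2 h : R * 'rV[R]_n -> R, {within Q, continuous h} &
        forall t x, 0 < t < T ->
          derivable (fun r => f (r, x)) t 1 /\ dt f (t, x) = h (t, x)),
      (forall i, {within Q, continuous (dx i f)} /\
        forall z, Q z -> derivable_x i f z) &
      (forall i j, {within Q, continuous (dx i (dx j f))} /\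
        forall z, Q z -> derivable_x i (dx j f) z)].

(* phi is an admissible test function on [0, T] x R^n, and g is a version of
   (- Delta)^s phi. *)
Definition admissible (R : realType) (n : nat) (s T : R)
    (phi g : R * 'rV[R]_n -> R) : Prop :=
  [/\ C12 T phi,
      (forall t x, 0 <= t <= T -> 0 <= phi (t, x)),
      (exists2 K : set 'rV[R]_n, compact K &
        forall t x, 0 <= t <= T -> ~ K x -> phi (t, x) = 0),
      (forall x, phi (T, x) = 0) &
      (forall t, 0 <= t <= T ->
        fraclap s (fun x => phi (t, x)) (fun x => g (t, x))) /\
      (lebtx R n).-integrable (cyl n `]0, T[) (EFin \o g)].

Definition weak_solution (R : realType) (n : nat) (s p : R)
    (w : R * 'rV[R]_n -> R) (u0 : 'rV[R]_n -> R) (u : R * 'rV[R]_n -> R) :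
    Prop :=
  [/\ Lploctx p u,
      {ae lebtx R n, forall z, 0 <= z.1 -> 0 <= u z},
      (forall T, 0 < T -> (lebtx R n).-integrable (cyl n `]0, T[)
        (fun z => (u z * (1 + enorm z.2) `^ (- (n%:R + 2 * s)))%:E)) &
      forall T phi g, 0 < T -> admissible s T phi g ->
        (\int[lebtx R n]_(z in cyl n `]0%R, T[)
            ((`|u z| `^ p + w z) * phi z)%:E
          + \int[leb R n]_x (u0 x * phi (0, x))%:E
        = - (\int[lebtx R n]_(z in cyl n `]0%R, T[) (u z * dt phi z)%:E)
          + \int[lebtx R n]_(z in cyl n `]0%R, T[) (u z * g z)%:E)%E].

Definition has_global_weak_solution (R : realType) (n : nat) (s p : R)
    (w : R * 'rV[R]_n -> R) : Prop :=
  exists (u0 : 'rV[R]_n -> R) (u : R * 'rV[R]_n -> R),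
    [/\ L1loc u0, {ae leb R n, forall x, 0 <= u0 x} &
        weak_solution s p w u0 u].

Definition fujita_exponent (R : realType) (n : nat) (s gamma m : R) : \bar R :=
  let d := n%:R - gamma - 2 * s * m in
  if d <= 2 * s then +oo%E else (d / (d - 2 * s))%:E.

(* Main.v *)
Require Import Defs.
From HB Require Import structures.
From mathcomp Require Import all_boot all_order all_algebra.
From mathcomp Require Import all_classical all_reals all_analysis.
From mathcomp Require Import measurable_realfun ring lra complex.

Import Order.TTheory GRing.Theory Num.Theory.
Import numFieldNormedType.Exports.

Local Open Scope classical_set_scope.
Local Open Scope ring_scope.

Set Implicit Arguments.
Unset Strict Implicit.
Unset Printing Implicit Defensive.

(** This is the test function method. Write [psi x] for the cutoff
    [max 0 (1 - |x|^2 / r^2)], let [T = r^(2s)] and let [q] be the conjugate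
    exponent of [p]. For an integer [K >= max q 3], test the weak formulation
    on ]0, T[ against

      phi (t, x) = (1 - t/T)^K * psi(x)^K.

    The initial datum contributes a nonnegative term, so

      int (u^p + w) phi <= - int u phi_t + int u (-Delta)^s phi.

    Both [- phi_t] and [(-Delta)^s phi] are at most [M = C r^(-2s)] times a
    product in which one of the two factors of [phi] has lost a single power.
    Young's inequality [u M <= u^p / 4 + C M^q] absorbs this loss because
    [q <= K]; it returns half of [int u^p phi], which is moved to the left, and
    leaves ([integral_source_le])

      int w phi <= C * M^q * (T r^N) = C r^(N + 2s - 2s q).

    On the slab [T/4 <= t <= T/2, |x| <= r/2] the function [phi] is at least
    [4^(-K)], and the hypothesis on [w] gives ([integral_source_ge])

      int w phi >= c * T * T^m * r^gamma = c r^(2s (1 + m) + gamma).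

    The condition [p < p_F] says exactly that the second exponent exceeds the
    first ([subcritical_exponent]), a contradiction as [r] tends to infinity.

    The analytic input is the one-sided pointwise bound
    [(-Delta)^s psi^K <= K C r^(-2s) psi^(K-1)] ([fraclap_cutoff]), to be proved
    for the operator of symbol [|xi|^(2s)]. That operator is realised as the
    average of the symmetric differences
    [f x - (f (x + y) + f (x - y)) / 2] against the measure
    [|y|^(-N-2s) dy], up to a constant. This measure is the distribution of
    [y = a v], where [v] is Gaussian in R^N and [a > 0] has the infinite
    measure [a^(-1-2s) da]: the integral in [v] is then the Gaussian characteristic
    function, a product of one-dimensional ones, and scaling in [a] produces
    [|xi|^(2s)] ([levy_kernel]). Two facts about symmetric differences finish
    the proof. Convexity of [v |-> v^K] bounds those of [psi^K] from above by
    [K psi^(K-1) min(1, |y|^2 / r^2)] ([sdiff_cutoff]). And their integral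
    over [x] vanishes, so that the same upper bound also controls their
    L^1 norm ([integral_abs_sdiff]), which is what Fubini's theorem requires
    in the computation of the Fourier transform ([fraclap_levy_op]). *)

(** * Changes of variables and measurability in R^n *)

(** Both [lebesgue_measure] and [a] times the image of Lebesgue measure under
    the affine map give the same mass to intervals, hence they are equal. *)
Lemma ge0_integral_affine (R : realType) (a b : R) (f : R -> \bar R) :
  0 < a -> measurable_fun [set: R] f -> (forall x, (0 <= f x)%E) ->
  (\int[lebesgue_measure]_x f (a * x + b)%R
    = a^-1%:E * \int[lebesgue_measure]_x f x)%E.
Proof.
move=> a0 mf f0.
pose phi := (fun x => a * x + b) : measurableTypeR R -> measurableTypeR R.
have mphi : measurable_fun setT phi.
  by apply: measurable_funD => //; exact: measurable_funM.
have ai0 : 0 <= a by rewrite ltW.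
pose m20 : {measure set (measurableTypeR R) -> \bar R} :=
  mscale (NngNum ai0) (pushforward lebesgue_measure phi).
pose m2 := m20 mphi.
have E (A : set (measurableTypeR R)) : measurable A -> lebesgue_measure A = m2 A.
  apply: lebesgue_measure_unique => _ [[c d]] _ <-.
  rewrite /m2 /m20 /= /mscale /= /pushforward.
  have -> : phi @^-1` `]c, d]%classic = `](c - b) / a, (d - b) / a]%classic.
    apply/seteqP; split => x /=; rewrite !in_itv /= /phi ltr_pdivrMr// ler_pdivlMr// ltrBlDr lerBrDr mulrC//.
  rewrite !lebesgue_measure_itv/= !lte_fin ltr_pM2r ?invr_gt0// ltrD2r.
  case: ifP => _; last by rewrite mule0.
  by rewrite -EFinM -mulrBl opprB addrA subrK mulrCA divff ?gt_eqF// mulr1.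
have -> : (\int[lebesgue_measure]_x f x = \int[m2]_x f x)%E.
  by apply: eq_measure_integral => A mA _; exact: E.
rewrite ge0_integral_mscale//= ge0_integral_pushforward//= muleA -EFinM mulVf ?gt_eqF//.
by rewrite mul1e.
Qed.

Lemma integral_leb_cons (R : realType) (n : nat) (f : 'rV[R]_n.+1 -> \bar R) :
  measurable_fun setT f -> (forall x, (0 <= f x)%E) ->
  (\int[leb R n.+1]_x f x =
   \int[lebesgue_measure]_a \int[leb R n]_v f (rV_cons (a, v)))%E.
Proof.
move=> mf f0.
have mc := @measurable_rV_cons R n.
have := @fubini_tonelli1 _ _ _ _ _ lebesgue_measure (leb R n)
  (f \o @rV_cons R n).
rewrite /fubini_F /= => <-//; last first.
  exact: measurableT_comp.
rewrite -[LHS]/(\int[pushforward (lebesgue_measure \x leb R n) (@rV_cons R n)]_x f x)%E.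
by rewrite ge0_integral_pushforward.
Qed.

Lemma measurable_dot (R : realType) (n : nat) d (T : measurableType d)
    (f g : T -> 'rV[R]_n) :
  measurable_fun setT f -> measurable_fun setT g ->
  measurable_fun setT (fun z => dot (f z) (g z)).
Proof.
move=> mf mg; rewrite /dot; apply: measurable_sum => i.
apply: measurable_funM.
  exact: (measurableT_comp (measurable_rV_coord i) mf).
exact: (measurableT_comp (measurable_rV_coord i) mg).
Qed.

Lemma measurable_enorm (R : realType) (n : nat) :
  measurable_fun setT (@enorm R n).
Proof.
apply: measurableT_comp; last exact: measurable_dot.
by apply: continuous_measurable_fun; exact: sqrt_continuous.
Qed.

Lemma measurable_eball (R : realType) (n : nat) (r : R) :
  measurable (eball n r).
Proof.
rewrite -[X in measurable X]setTI.
rewrite (_ : eball n r = @enorm R n @^-1` `]-oo, r]%classic).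
  exact: measurable_enorm.
by apply/seteqP; split => x /=; rewrite in_itv.
Qed.

Lemma measurable_rVD (R : realType) (n : nat) d (T : measurableType d)
    (f g : T -> 'rV[R]_n) :
  measurable_fun setT f -> measurable_fun setT g ->
  measurable_fun setT (fun z => f z + g z).
Proof.
move=> mf mg; apply: measurable_fun_rVP => i.
rewrite (_ : _ \o _ = fun z => rV_coord i (f z) + rV_coord i (g z)).
  by apply: measurable_funD;
    apply: measurableT_comp => //; exact: measurable_rV_coord.
by apply/funext => z /=; rewrite /rV_coord mxE.
Qed.

Lemma measurable_rVZ (R : realType) (n : nat) d (T : measurableType d)
    (a : T -> R) (g : T -> 'rV[R]_n) :
  measurable_fun setT a -> measurable_fun setT g ->
  measurable_fun setT (fun z => a z *: g z).
Proof.
move=> mf mg; apply: measurable_fun_rVP => i.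
rewrite (_ : _ \o _ = fun z => a z * rV_coord i (g z)).
  apply: measurable_funM => //.
  by apply: measurableT_comp => //; exact: measurable_rV_coord.
by apply/funext => z /=; rewrite /rV_coord mxE.
Qed.

Lemma rV_consD (R : realType) (n : nat) (a b : R) (v w : 'rV[R]_n) :
  rV_cons (a + b, v + w) = rV_cons (a, v) + rV_cons (b, w).
Proof. by rewrite /rV_cons /= (@add_row_mx _ 1 1 n) raddfD. Qed.

Lemma dot_cons (R : realType) (n : nat) (a b : R) (v w : 'rV[R]_n) :
  dot (rV_cons (a, v)) (rV_cons (b, w)) = a * b + dot v w.
Proof.
rewrite /dot /rV_cons/= (@big_split_ord _ _ _ 1%N n) /= big_ord1.
congr (_ + _); first by rewrite !(@row_mxEl _ 1 1 n) !mxE.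
by apply: eq_bigr => i _; rewrite !(@row_mxEr _ 1 1 n).
Qed.

(** Induction on the dimension: the tail is translated by the induction
    hypothesis and the first coordinate by [ge0_integral_affine]. *)
Lemma ge0_integral_leb_translate (R : realType) (n : nat) (y : 'rV[R]_n)
    (f : 'rV[R]_n -> \bar R) :
  measurable_fun setT f -> (forall x, (0 <= f x)%E) ->
  (\int[leb R n]_x f (x + y)%R = \int[leb R n]_x f x)%E.
Proof.
elim: n y f => [|n IH] y f mf f0.
  by apply: eq_integral => x _; congr f; apply/rowP => -[].
have mfy : measurable_fun setT (fun x : 'rV[R]_n.+1 => f (x + y)).
  by apply: (measurableT_comp mf); exact: measurable_rVD.
rewrite (integral_leb_cons mf f0) (integral_leb_cons mfy (fun x => f0 _)).
rewrite -(rV_unconsK y); case: (rV_uncons y) => b w.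
under eq_integral => a _.
  under eq_integral => v _ do rewrite -rV_consD.
  rewrite (IH w (fun v => f (rV_cons (a + b, v))))//; last first.
    apply: measurableT_comp => //; apply: measurableT_comp => //.
      exact: measurable_rV_cons.
  over.
rewrite /=.
have := @ge0_integral_affine R 1 b
  (fun a => (\int[leb R n]_v f (rV_cons (a, v)))%E) ltr01.
rewrite invr1 mul1e => <-.
- by apply: eq_integral => a _; rewrite mul1r.
- apply: (@measurable_fun_fubini_tonelli_F _ _ _ _ _ (leb R n) (f \o @rV_cons R n)) => //.
  by apply: measurableT_comp => //; exact: measurable_rV_cons.
- by move=> x; exact: f0.
- by move=> a; apply: integral_ge0 => v _; exact: f0.
Qed.

(** * The Gaussian characteristic function on the line *)

(** Fundamental theorem of calculus on [-n, n], then dominated convergence. It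
    serves to integrate by parts over the whole line: [F] is the product. *)
Lemma integral_derivative_eq0 (R : realType) (F f : R -> R) :
  (forall x : R, is_derive x 1 F (f x)) -> continuous f ->
  lebesgue_measure.-integrable setT (EFin \o f) ->
  F x @[x --> +oo%R] --> (0 : R) -> F x @[x --> -oo%R] --> (0 : R) ->
  \int[lebesgue_measure]_x f x = 0.
Proof.
move=> dF cf intf Fy FNy.
have mf : measurable_fun [set: R] (EFin \o f) by exact: measurable_int intf.
pose f_ := fun n : nat => (EFin \o f) \_ (`[- n.+1%:R, n.+1%:R] : set R).
have mf_ n : measurable_fun [set: R] (f_ n).
  apply/(measurable_restrictT _ _).1; first exact: measurable_itv.
  exact: measurable_funTS.
have cvf x : f_ n x @[n --> \oo] --> (EFin \o f) x.
  apply: cvg_near_cst; exists (Num.truncn `|x|) => // n /= nx.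
  rewrite /f_ patchE mem_set//= in_itv/= -ler_norml.
  by rewrite (le_trans (ltW (truncnS_gt _)))// ler_nat ltnS.
have lef x n : (`|f_ n x| <= (abse \o (EFin \o f)) x)%E.
  rewrite /f_ /= patchE; case: ifPn => //= _.
  by rewrite normr0 lee_fin.
have [_ _] := @dominated_convergence _ _ _ lebesgue_measure setT measurableT
  f_ (EFin \o f) (abse \o (EFin \o f)) mf_ mf
  (aeW _ (fun (x : measurableTypeR R) (_ : [set: R] x) => cvf x))
  (integrable_abse intf) (aeW _ (fun (x : measurableTypeR R) n (_ : [set: R] x) => lef x n)).
rewrite (_ : [sequence _]_n = fun n => (F n.+1%:R - F (- n.+1%:R))%:E); last first.
  apply/funext => n; rewrite /= -integral_mkcond.
  rewrite (@continuous_FTC2 _ f F).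
  - by rewrite EFinB.
  - by rewrite -subr_gt0 opprK addr_gt0.
  - exact: continuous_subspaceT.
  - split.
    + by move=> x _; apply: ex_derive.
    + apply: cvg_at_right_filter.
      exact/differentiable_continuous/derivable1_diffP/ex_derive.
    + apply: cvg_at_left_filter.
      exact/differentiable_continuous/derivable1_diffP/ex_derive.
  - by move=> x _; rewrite derive1E; apply: derive_val.
move=> cvI.
have cv0 : (F n.+1%:R - F (- n.+1%:R))%:E @[n --> \oo] --> (0 : R)%:E.
  apply: cvg_EFin; first exact: nearW.
  rewrite -[X in _ --> X](subr0 0); apply: cvgB.
    apply: (cvg_comp (fun n => n.+1%:R : R) F _ Fy).
    rewrite (cvg_shiftS (fun n => n%:R : R)).
    exact: cvgr_idn.
  apply: (cvg_comp (fun n => - n.+1%:R : R) F _ FNy).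
  rewrite (cvg_shiftS (fun n => - n%:R : R)).
  by apply/cvgNrNy; exact: cvgr_idn.
rewrite /Rintegral.
rewrite -[RHS]/(fine 0%:E); congr fine.
by apply: (cvg_unique _ cvI cv0).
Qed.

Lemma integrable_gauss_half (R : realType) :
  lebesgue_measure.-integrable setT (fun x : R => (expR (- (x ^+ 2 / 2)))%:E).
Proof.
have := @integrable_normal_pdf R 0 1.
have s0 : (1 : R) != 0 by exact: oner_neq0.
rewrite (normal_pdfE 0 s0).
have p0 := normal_peak_gt0 s0.
move=> /(integrableZl measurableT (normal_peak 1)^-1).
apply: eq_integrable => // x _.
rewrite /= -EFinM mulrA mulVf ?gt_eqF// mul1r.
by rewrite /normal_fun subr0 expr1n mulNr.
Qed.

(** One factor [|x|] costs half of the exponent; this makes every first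
    moment against the Gaussian integrable by [integrable_gauss_dominated]. *)
Lemma gauss_moment1 (R : realType) (x : R) :
  `|x| * gauss_fun x <= expR (- (x ^+ 2 / 2)).
Proof.
rewrite /gauss_fun (_ : - x ^+ 2 = - (x ^+ 2 / 2) - x ^+ 2 / 2); last by field.
rewrite expRD [X in _ * X]mulrC mulrA ler_piMl ?expR_ge0//.
rewrite expRN ler_pdivrMr ?expR_gt0// mul1r (le_trans _ (expR_ge1Dx _))//.
have := sqr_ge0 (`|x| - 1); rewrite -(real_normK (num_real x)); nra.
Qed.

Lemma gauss_le_half (R : realType) (x : R) :
  gauss_fun x <= expR (- (x ^+ 2 / 2)).
Proof.
rewrite ler_expR lerN2; have := sqr_ge0 x; lra.
Qed.

Lemma integrable_gauss_dominated (R : realType) (h : R -> R) :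
  measurable_fun [set: R] h -> (forall x, `|h x| <= 1 + `|x|) ->
  lebesgue_measure.-integrable setT (fun x : R => (gauss_fun x * h x)%:E).
Proof.
move=> mh hle.
apply: (@le_integrable _ _ _ lebesgue_measure setT measurableT _
  (fun x : R => 2%:E * (expR (- (x ^+ 2 / 2)))%:E)%E).
- apply/measurable_EFinP; apply: measurable_funM => //.
  exact: measurable_gauss_fun.
- move=> /= x _; rewrite lee_fin normrM (ger0_norm (gauss_fun_ge0 (x : R))).
  rewrite [leRHS]ger0_norm ?mulr_ge0 ?expR_ge0//.
  have := gauss_moment1 x; have := gauss_le_half x; have := gauss_fun_ge0 x.
  have := hle x; have := normr_ge0 (h x). nra.
- exact: (integrableZl measurableT 2 (integrable_gauss_half R)).
Qed.

Lemma cvg_gauss_bounded (R : realType) (h : R -> R) (F : set_system R) :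
  Filter F -> gauss_fun x @[x --> F] --> (0:R) -> (forall x, `|h x| <= 1) ->
  gauss_fun x * h x @[x --> F] --> (0:R).
Proof.
move=> FF g0 hle.
apply/cvgr0Pnorm_le => /= e e0.
move/cvgr0Pnorm_le : g0 => /(_ _ e0).
apply: filterS => x; rewrite normrM => /(le_trans _); apply.
by rewrite ler_piMr.
Qed.

Section gauss_characteristic_function.
Variables (R : realType) (c : R).

Let J xi : R := \int[lebesgue_measure]_x (gauss_fun x * cos (x * xi + c)).

Let mphase (h : R -> R) xi : continuous h ->
  measurable_fun [set: R] (fun x => h (x * xi + c)).
Proof.
move=> ch; apply: (measurableT_comp (continuous_measurable_fun ch)).
by apply: measurable_funD => //; exact: measurable_funM.
Qed.

Let igcos xi : lebesgue_measure.-integrable setT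
  (fun x : R => (gauss_fun x * cos (x * xi + c))%:E).
Proof.
apply: integrable_gauss_dominated => [|x].
  by apply: mphase; exact: continuous_cos.
by rewrite (le_trans (cos_max _))// lerDl.
Qed.

Let igxsin xi : lebesgue_measure.-integrable setT
  (fun x : R => (gauss_fun x * (x * sin (x * xi + c)))%:E).
Proof.
apply: integrable_gauss_dominated => [|x].
  by apply: measurable_funM => //; apply: mphase; exact: continuous_sin.
rewrite normrM (@le_trans _ _ `|x|) ?lerDr// ler_piMr//.
exact: sin_max.
Qed.

Let dgauss (x : R) : is_derive x 1 (@gauss_fun R) (- (2 * x * gauss_fun x)).
Proof.
rewrite /gauss_fun; apply: trigger_derive; rewrite /GRing.scale /=; ring.
Qed.

Let dcosx (xi x : R) : is_derive xi 1 (fun xi => gauss_fun x * cos (x * xi + c))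
  (- (gauss_fun x * (x * sin (x * xi + c)))).
Proof.
apply: trigger_derive; rewrite /GRing.scale /=; ring.
Qed.

Let parts (xi : R) : \int[lebesgue_measure]_x
  (xi * (gauss_fun x * cos (x * xi + c)) -
   2 * (gauss_fun x * (x * sin (x * xi + c)))) = 0.
Proof.
apply: (integral_derivative_eq0 (F := fun x => gauss_fun x * sin (x * xi + c))).
- move=> x; have := dgauss x => ?.
  apply: trigger_derive; rewrite /GRing.scale /=; ring.
- move=> x.
  have cx : {for x, continuous (fun z : R => z * xi + c)}.
    apply: cvgD; last exact: cvg_cst.
    by apply: cvgM => //; exact: cvg_cst.
  apply: cvgB; apply: cvgM => //; try exact: cvg_cst.
    apply: cvgM; first exact: continuous_gauss_fun.
    by apply: (continuous_comp cx); exact: continuous_cos.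
  apply: cvgM; first exact: continuous_gauss_fun.
  apply: cvgM => //.
  by apply: (continuous_comp cx); exact: continuous_sin.
- rewrite (_ : _ \o _ = (fun x => xi%:E * (gauss_fun x * cos (x * xi + c))%:E)
     \- (fun x => 2%:E * (gauss_fun x * (x * sin (x * xi + c)))%:E))%E//.
  by apply: integrableB => //; apply: integrableZl => //.
- apply: cvg_gauss_bounded; first exact: cvg_gauss_fun.
  by move=> x; exact: sin_max.
- apply: cvg_gauss_bounded; last by move=> x; exact: sin_max.
  apply/cvgNy_compNP; rewrite (_ : _ \o _ = @gauss_fun R); first exact: cvg_gauss_fun.
  by apply/funext => x; rewrite /= /gauss_fun sqrrN.
Qed.

Let alg (xi A B : R) : xi * A - 2 * B = 0 -> -1 * B = - (xi / 2) * A.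
Proof. lra. Qed.

Let dJ (xi : R) : is_derive xi 1 J (- (xi / 2) * J xi).
Proof.
have pE (x y : R) : derive1 (fun z : R => gauss_fun y * cos (y * z + c) : R) x =
    - (gauss_fun y * (y * sin (y * x + c))).
  by rewrite derive1E; apply: derive_val.
have dd : derivable J xi 1 /\ derive1 J xi =
    \int[lebesgue_measure]_x (- (gauss_fun x * (x * sin (x * xi + c)))).
  have Ixi : (`](xi - 1), (xi + 1)[%classic : set R) xi.
    by rewrite /= in_itv/=; apply/andP; split; lra.
  pose f := fun z y : R => gauss_fun y * cos (y * z + c).
  have f2 z y : (`](xi - 1), (xi + 1)[%classic : set R) z -> [set: R] y -> derivable (f ^~ y) z 1.
    by move=> _ _; apply: ex_derive; exact: dcosx.
  (* The partial derivative in [xi] is dominated by [gauss_fun y * `|y|],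
     uniformly in [xi]. *)
  have f3 : lebesgue_measure.-integrable setT (EFin \o (fun y : R => gauss_fun y * `|y|)).
    apply: (@integrable_gauss_dominated _ (fun y => `|y|)); first exact: normr_measurable.
    by move=> y; rewrite normr_id lerDr.
  have f4 z y : (`](xi - 1), (xi + 1)[%classic : set R) z -> [set: R] y -> `|partial1of2 f z y| <= gauss_fun y * `|y|.
    move=> _ _; rewrite /partial1of2 pE normrN normrM ger0_norm ?gauss_fun_ge0//.
    rewrite ler_wpM2l ?gauss_fun_ge0// normrM ler_piMr//; exact: sin_max.
  have f5 (y : R) : 0 <= gauss_fun y * `|y| by rewrite mulr_ge0 ?gauss_fun_ge0.
  have f1' z : (`](xi - 1), (xi + 1)[%classic : set R) z -> lebesgue_measure.-integrable setT (EFin \o f z).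
    by move=> _; exact: igcos.
  split.
    exact: (derivable_under_integral measurableT Ixi f1' f2 f5 f3 f4).
  rewrite (differentiation_under_integral measurableT Ixi f1' f2 f5 f3 f4).
  by apply: eq_Rintegral => y _; rewrite /partial1of2 pE.
split; first exact: dd.1.
rewrite -derive1E dd.2.
have := parts xi; rewrite RintegralB//; last 2 first.
- exact: (integrableZl measurableT xi (igcos xi)).
- exact: (integrableZl measurableT 2 (igxsin xi)).
rewrite !RintegralZl//; last 2 first.
- exact: igxsin.
- exact: igcos.
move=> h; under eq_Rintegral do rewrite -mulN1r.
rewrite RintegralZl//; last exact: igxsin.
exact: alg h.
Qed.

(** [J' = - (xi / 2) J], by differentiation under the integral followed by an
    integration by parts, so that [J xi * exp (xi^2 / 4)] is constant. The
    phase [c] is carried along because the induction on the dimension in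
    [gauss_characteristic] freezes the other coordinates into it. *)
Lemma gauss_characteristic1 xi :
  \int[lebesgue_measure]_x (gauss_fun x * cos (x * xi + c)) =
  Num.sqrt pi * expR (- (xi ^+ 2 / 4)) * cos c.
Proof.
rewrite -/(J xi).
have E : J xi * expR (xi ^+ 2 / 4) = J 0 * expR (0 ^+ 2 / 4).
  apply: (@is_derive_0_is_cst _ (fun z => J z * expR (z ^+ 2 / 4))) => x.
  have := dJ x => ?.
  apply: trigger_derive; rewrite /GRing.scale /=; by field.
have J0 : J 0 = Num.sqrt pi * cos c.
  rewrite /J; under eq_Rintegral do rewrite mulr0 add0r.
  rewrite RintegralZr//; last exact: integrableT_gauss.
  by rewrite /Rintegral integralT_gauss.
move: E; rewrite expr0n /= mul0r expR0 mulr1 J0 => E.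
by rewrite expRN mulrAC -E mulfK// gt_eqF// expR_gt0.
Qed.

End gauss_characteristic_function.

(** * The Gaussian characteristic function in R^n *)

Lemma integral_leb_cons_integrable (R : realType) (n : nat)
    (f : 'rV[R]_n.+1 -> \bar R) :
  (leb R n.+1).-integrable setT f ->
  (\int[leb R n.+1]_x f x =
   \int[lebesgue_measure]_a \int[leb R n]_v f (rV_cons (a, v)))%E.
Proof.
move=> intf.
have mf : measurable_fun setT f by exact: measurable_int intf.
have mc := @measurable_rV_cons R n.
have mfc : measurable_fun setT (f \o @rV_cons R n) by exact: measurableT_comp.
have intfc : (lebesgue_measure \x leb R n)%E.-integrable setT (f \o @rV_cons R n).
  apply/integrableP; split => //.
  move/integrableP : intf => [_]; apply: le_lt_trans.
  rewrite -[leRHS]/(\int[pushforward (lebesgue_measure \x leb R n) (@rV_cons R n)]_x `|f x|)%E.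
  rewrite ge0_integral_pushforward//.
  exact: measurableT_comp.
rewrite -[LHS]/(\int[pushforward (lebesgue_measure \x leb R n) (@rV_cons R n)]_x f x)%E.
rewrite integral_pushforward//=.
by rewrite -(integral12_prod_meas1 intfc).
Qed.

Lemma measurable_expR_dot (R : realType) (n : nat) (a : R) :
  measurable_fun setT (fun v : 'rV[R]_n => expR (- (a * dot v v))).
Proof.
apply: measurableT_comp => //; apply: measurableT_comp => //.
by apply: measurable_funM => //; exact: measurable_dot.
Qed.

Lemma measurable_expR_dotE (R : realType) (n : nat) (a : R) :
  measurable_fun setT (fun v : 'rV[R]_n => (expR (- (a * dot v v)))%:E).
Proof. by apply/measurable_EFinP; exact: measurable_expR_dot. Qed.

(** The exponential of a sum of squares is a product over the coordinates, so
    that the integral is a power of the one-dimensional one. *)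
Lemma integral_expR_dot (R : realType) (n : nat) (a I : R) :
  0 <= I ->
  (\int[lebesgue_measure]_x (expR (- (a * x ^+ 2)))%:E = I%:E)%E ->
  (\int[leb R n]_v (expR (- (a * dot v v)))%:E = (I ^+ n)%:E)%E.
Proof.
move=> I0 aI; elim: n => [|n IH].
  rewrite expr0 /leb /= integral_dirac// /=.
    by rewrite /dot big_ord0 mulr0 oppr0 expR0 diracT mul1e.
  exact: measurable_expR_dotE.
rewrite integral_leb_cons//=; last first.
  exact: measurable_expR_dotE.
under eq_integral => x _.
  under eq_integral => v _ do rewrite dot_cons mulrDr opprD expRD EFinM.
  rewrite ge0_integralZl//=; last exact: measurable_expR_dotE.
  rewrite IH muleC.
  over.
rewrite /= ge0_integralZl//=; last first.
- by rewrite lee_fin exprn_ge0.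
- apply/measurable_EFinP; apply: measurableT_comp => //; apply: measurableT_comp => //.
  by apply: measurable_funM => //; exact: measurable_funM.
under eq_integral do rewrite -expr2.
by rewrite aI -EFinM -exprSr.
Qed.

Definition gaussv (R : realType) (n : nat) (v : 'rV[R]_n) : R :=
  expR (- dot v v).

Lemma gaussv_ge0 (R : realType) (n : nat) (v : 'rV[R]_n) : 0 <= gaussv v.
Proof. exact: expR_ge0. Qed.

Lemma measurable_gaussv (R : realType) (n : nat) :
  measurable_fun setT (@gaussv R n).
Proof.
have := @measurable_expR_dot R n 1; rewrite /gaussv.
by under eq_fun do rewrite mul1r.
Qed.

Lemma gaussv_cons (R : realType) (n : nat) (a : R) (v : 'rV[R]_n) :
  gaussv (rV_cons (a, v)) = gauss_fun a * gaussv v.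
Proof. by rewrite /gaussv /gauss_fun dot_cons opprD expRD expr2. Qed.

Lemma integral_gaussv (R : realType) (n : nat) :
  (\int[leb R n]_v (gaussv v)%:E = (Num.sqrt pi ^+ n)%:E)%E.
Proof.
rewrite -(@integral_expR_dot R n 1 _ (sqrtr_ge0 pi)).
  by apply: eq_integral => v _; rewrite mul1r.
by rewrite -integralT_gauss; apply: eq_integral => x _; rewrite mul1r.
Qed.

Lemma integrable_gaussv_bounded (R : realType) (n : nat) (h : 'rV[R]_n -> R) :
  measurable_fun setT h -> (forall v, `|h v| <= 1) ->
  (leb R n).-integrable setT (fun v => (gaussv v * h v)%:E).
Proof.
move=> mh hle.
apply: (@le_integrable _ _ _ _ _ measurableT _ (fun v => (gaussv v)%:E)).
- by apply/measurable_EFinP; apply: measurable_funM => //; exact: measurable_gaussv.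
- move=> v _; rewrite !abse_EFin lee_fin normrM ler_piMr//.
- apply/integrableP; split; first by apply/measurable_EFinP; exact: measurable_gaussv.
  under eq_integral do rewrite /= ger0_norm ?gaussv_ge0//.
  by rewrite integral_gaussv ltry.
Qed.

(** Induction on the dimension. The phase [c] makes the real part of the
    characteristic function stable under slicing: integrating out the tail at
    fixed first coordinate [x] turns the phase [c] into [x * b + c]. *)
Lemma gauss_characteristic (R : realType) (n : nat) (xi : 'rV[R]_n) (c : R) :
  (\int[leb R n]_v (gaussv v * cos (dot v xi + c))%:E =
   (Num.sqrt pi ^+ n * expR (- (dot xi xi / 4)) * cos c)%:E)%E.
Proof.
have mg k (x : 'rV[R]_k) b : measurable_fun setT (fun v => cos (dot v x + b)).
  apply: (measurableT_comp (continuous_measurable_fun (@continuous_cos R))).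
  by apply: measurable_funD => //; exact: measurable_dot.
have mgg k (x : 'rV[R]_k) b :
    measurable_fun setT (fun v => (gaussv v * cos (dot v x + b))%:E).
  apply/measurable_EFinP.
  exact: (measurable_funM (@measurable_gaussv R k) (mg k x b)).
elim: n xi c => [|n IH] xi c.
  rewrite expr0 /leb /= integral_dirac// /=.
    by rewrite /gaussv /dot !big_ord0 !(mul0r, oppr0, expR0, diracT, mul1r, mul1e, add0r).
  exact: mgg.
rewrite integral_leb_cons_integrable; last first.
  by apply: integrable_gaussv_bounded => // v; exact: cos_max.
rewrite -(rV_unconsK xi); case: (rV_uncons xi) => b y {xi}.
under eq_integral => x _.
  under eq_integral => v _ do
    rewrite gaussv_cons dot_cons -mulrA addrAC [_ + dot _ _]addrC EFinM.
  rewrite integralZl//; last first.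
    by apply: integrable_gaussv_bounded => // v; exact: cos_max.
  rewrite IH -EFinM mulrCA EFinM.
  over.
rewrite /=.
have ig : lebesgue_measure.-integrable setT (fun x : R => (gauss_fun x * cos (x * b + c))%:E).
  apply: integrable_gauss_dominated => [|x].
    apply: (measurableT_comp (continuous_measurable_fun (@continuous_cos R))).
    by apply: measurable_funD => //; exact: measurable_funM.
  by rewrite (le_trans (cos_max _))// lerDl.
rewrite integralZl// -[X in (_ * X)%E]fineK; last exact: integrable_fin_num.
have := gauss_characteristic1 c b; rewrite /Rintegral => ->.
rewrite -EFinM dot_cons -expr2 mulrDl opprD expRD (exprSr (Num.sqrt pi)).
set e1 := expR _; set e2 := expR _; set S := Num.sqrt pi.
by rewrite -!mulrA (mulrCA e1) [in RHS](mulrCA e2).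
Qed.

(** * The kernel of the fractional Laplacian *)

Lemma integral_powR_itv (R : realType) (q a b : R) : q != 0 -> 0 < a < b ->
  (\int[lebesgue_measure]_(r in `[a, b]) (r `^ (q - 1))%:E =
   ((b `^ q - a `^ q) / q)%:E)%E.
Proof.
move=> q0 /andP[a0 ab].
have d (p x : R) : 0 < x -> derivable (fun r : R => r `^ p) x 1.
  by move=> x0; apply: ex_derive; exact: is_derive1_powR.
have c (p x : R) : 0 < x -> {for x, continuous (fun r : R => r `^ p)}.
  by move=> x0; exact/differentiable_continuous/derivable1_diffP/d.
rewrite (@continuous_FTC2 _ _ (fun r => r `^ q / q))//.
- by rewrite -EFinB mulrBl.
- apply: derivable_within_continuous => x; rewrite in_itv/= => /andP[ax _].
  by apply: d; exact: lt_le_trans ax.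
- split.
  + move=> x; rewrite in_itv/= => /andP[ax _].
    by apply: derivableM => //; apply: d; exact: lt_trans ax.
  + by apply: cvg_at_right_filter; apply: cvgM; [exact: c|exact: cvg_cst].
  + apply: cvg_at_left_filter; apply: cvgM; last exact: cvg_cst.
    by apply: c; exact: lt_trans ab.
- move=> x; rewrite in_itv/= => /andP[ax _].
  have x0 : 0 < x by exact: lt_trans ax.
  have dq := is_derive1_powR q x0.
  have {}dq : is_derive x 1 (fun r : R => r `^ q / q) (x `^ (q - 1)).
    by apply: trigger_derive; rewrite /GRing.scale/=; field.
  by rewrite derive1E; exact: derive_val.
Qed.

(** Monotone convergence along an exhaustion; it replaces the computation of
    improper integrals by uniform bounds on compact intervals. *)
Lemma ge0_integral_bigcup_le d (T : measurableType d) (R : realType)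
    (mu : {measure set T -> \bar R}) (F : (set T)^nat) (f : T -> \bar R)
    (M : \bar R) :
  nondecreasing_seq F -> (forall i, measurable (F i)) ->
  measurable_fun setT f -> (forall x, (0 <= f x)%E) ->
  (forall i, (\int[mu]_(x in F i) f x <= M)%E) ->
  (\int[mu]_(x in \bigcup_i F i) f x <= M)%E.
Proof.
move=> ndF mF mf f0 le.
have cv := @ge0_nondecreasing_set_cvg_integral _ _ _ F f mu ndF mF
  (fun i => measurable_funTS mf) (fun i x _ => f0 x).
rewrite -(cvg_lim _ cv)//; apply: lime_le; last exact: nearW.
by apply/cvg_ex; eexists; exact: cv.
Qed.

(** The density [r^(-1-2s)] of the scale [r] on the positive half line,
    extended by zero so that integrals run over all of R. *)
Definition levy_weight (R : realType) (s r : R) : R :=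
  if 0 < r then r `^ (- (1 + 2 * s)) else 0.

Lemma levy_weight_ge0 (R : realType) (s r : R) : 0 <= levy_weight s r.
Proof. by rewrite /levy_weight; case: ifP => // _; exact: powR_ge0. Qed.

Lemma measurable_levy_weight (R : realType) (s : R) :
  measurable_fun [set: R] (levy_weight s).
Proof.
rewrite (_ : levy_weight s =
  (fun r => r `^ (- (1 + 2 * s))) \_ (`]0, +oo[ : set R)).
  apply/(measurable_restrictT _ _).1 => //.
  by apply: measurable_funTS; exact: measurable_powR.
by apply/funext => r; rewrite patchE /levy_weight mem_setE in_itv/= andbT.
Qed.

Lemma levy_weight_scale (R : realType) (s l r : R) : 0 < l ->
  levy_weight s (l * r) = l `^ (- (1 + 2 * s)) * levy_weight s r.
Proof.
move=> l0; rewrite /levy_weight pmulr_rgt0//; case: ifP => r0; last by rewrite mulr0.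
by rewrite powRM// ltW.
Qed.

(** The measure [r^(-1-2s) dr] is homogeneous of degree [-2s]. This is the
    only source of the powers [|xi|^(2s)] and [rho^(-2s)] below. *)
Lemma integral_levy_scale (R : realType) (s l : R) (h : R -> R) :
  0 < l -> measurable_fun [set: R] h -> (forall r, 0 <= h r) ->
  (\int[lebesgue_measure]_r (levy_weight s r * h (l * r)%R)%:E =
   (l `^ (2 * s))%:E * \int[lebesgue_measure]_r (levy_weight s r * h r)%:E)%E.
Proof.
move=> l0 mh h0.
have mf : measurable_fun [set: R] (fun r => (levy_weight s r * h r)%:E).
  by apply/measurable_EFinP; apply: measurable_funM => //; exact: measurable_levy_weight.
have f0 (r : R) : (0 <= (levy_weight s r * h r)%:E)%E.
  by rewrite lee_fin mulr_ge0 ?levy_weight_ge0.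
have := ge0_integral_affine 0 l0 mf f0.
under eq_integral do rewrite addr0 levy_weight_scale// -mulrA EFinM.
have mf' : measurable_fun [set: R] (fun r => (levy_weight s r * h (l * r)%R)%:E).
  apply/measurable_EFinP; apply: measurable_funM => //; first exact: measurable_levy_weight.
  by apply: measurableT_comp => //; exact: measurable_funM.
rewrite ge0_integralZl//=; last 2 first.
- by move=> r _; rewrite lee_fin mulr_ge0 ?levy_weight_ge0.
- by rewrite lee_fin powR_ge0.
move/(congr1 (fun x => (l `^ (1 + 2 * s))%:E * x)%E).
rewrite !muleA -!EFinM powRN mulfV ?gt_eqF ?powR_gt0// mul1e => ->.
have -> : l `^ (1 + 2 * s) = l * l `^ (2 * s).
  rewrite (@powRD _ l 1); first by rewrite powRr1// ltW.
  by rewrite (gt_eqF l0) implybT.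
by rewrite mulrAC mulfV ?gt_eqF// mul1r.
Qed.

(** Near zero the integrand is [r^(1-2s)], integrable because [s < 1]; at
    infinity it is [r^(-1-2s)], integrable because [0 < s]. *)
Lemma integral_levy_min (R : realType) (s : R) : 0 < s < 1 ->
  (\int[lebesgue_measure]_r (levy_weight s r * Num.min 1 (r ^+ 2))%:E < +oo)%E.
Proof.
move=> /andP[s0 s1].
set q1 := 2 - 2 * s; set q2 := - (2 * s).
have q10 : 0 < q1 by rewrite /q1; lra.
have q20 : q2 < 0 by rewrite /q2; lra.
have mp (q : R) : measurable_fun [set: R] (fun r => (r `^ q)%:E).
  by apply/measurable_EFinP; exact: measurable_powR.
have p0 (q x : R) : (0 <= (x `^ q)%:E)%E by rewrite lee_fin powR_ge0.
have I1 : (\int[lebesgue_measure]_(r in `]0%R, 1%R]) (r `^ (q1 - 1))%:E <= (q1^-1)%:E)%E.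
  have -> : `]0, 1]%classic = \bigcup_n (`[n.+2%:R^-1, 1]%classic : set R).
    apply/seteqP; split => [x|x [n _]] /=; rewrite !in_itv/=; last first.
      by move=> /andP[nx ->]; rewrite (lt_le_trans _ nx)// invr_gt0.
    move=> /andP[x0 x1]; exists (Num.truncn x^-1) => //=; rewrite in_itv/= x1 andbT.
    rewrite invf_ple ?posrE// (le_trans (ltW (truncnS_gt _)))// ler_nat//.
  apply: ge0_integral_bigcup_le => //.
  - apply/nondecreasing_seqP => n; rewrite subsetEset => x /=; rewrite !in_itv/=.
    move=> /andP[nx ->]; rewrite andbT (le_trans _ nx)//.
    by rewrite lef_pV2 ?posrE// ler_nat.
  - exact: mp.
  - move=> n; rewrite integral_powR_itv ?gt_eqF//; last first.
      by rewrite invr_gt0 ltr0n/= invf_lt1// ltr1n.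
    rewrite lee_fin powR1 ler_pdivrMr// mulVf ?gt_eqF// gerBl powR_ge0.
have I2 : (\int[lebesgue_measure]_(r in `[1%R, +oo[) (r `^ (q2 - 1))%:E <= ((2 * s)^-1)%:E)%E.
  have -> : `[1, +oo[%classic = \bigcup_n (`[1, n.+2%:R]%classic : set R).
    apply/seteqP; split => [x|x [n _]] /=; rewrite !in_itv/= ?andbT; last by case/andP.
    move=> x1; exists (Num.truncn x) => //=; rewrite in_itv/= x1/=.
    by rewrite (le_trans (ltW (truncnS_gt _)))// ler_nat.
  apply: ge0_integral_bigcup_le => //.
  - apply/nondecreasing_seqP => n; rewrite subsetEset => x /=; rewrite !in_itv/=.
    by move=> /andP[-> /le_trans]; apply; rewrite ler_nat.
  - exact: mp.
  - move=> n; rewrite integral_powR_itv ?lt_eqF//; last by rewrite ltr01 ltr1n.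
    rewrite lee_fin powR1 /q2 invrN mulrN -mulNr opprB ler_pdivrMr ?mulr_gt0//.
    by rewrite mulVf ?gt_eqF ?mulr_gt0// gerBl powR_ge0.
apply: (@le_lt_trans _ _ (q1^-1 + (2 * s)^-1)%:E); last by rewrite ltry.
pose f1 := (fun r : R => (r `^ (q1 - 1))%:E) \_ (`]0, 1] : set R).
pose f2 := (fun r : R => (r `^ (q2 - 1))%:E) \_ (`[1, +oo[ : set R).
have mf1 : measurable_fun [set: R] f1.
  by apply/(measurable_restrictT _ _).1 => //; exact: measurable_funTS.
have mf2 : measurable_fun [set: R] f2.
  by apply/(measurable_restrictT _ _).1 => //; exact: measurable_funTS.
have f10 x : (0 <= f1 x)%E by apply: erestrict_ge0 => *; exact: p0.
have f20 x : (0 <= f2 x)%E by apply: erestrict_ge0 => *; exact: p0.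
apply: (@le_trans _ _ (\int[lebesgue_measure]_r (f1 r + f2 r))%E); last first.
  rewrite ge0_integralD//= EFinD; apply: leeD.
    by rewrite -integral_mkcond.
  by rewrite -integral_mkcond.
apply: ge0_le_integral => //.
- move=> r _; rewrite lee_fin mulr_ge0 ?levy_weight_ge0//.
  by rewrite le_min ler01 sqr_ge0.
- apply/measurable_EFinP; apply: measurable_funM; first exact: measurable_levy_weight.
  by apply: measurable_minr => //; exact: measurable_funX.
- exact: emeasurable_funD.
- move=> r _; rewrite /levy_weight; case: ifPn => r0; last first.
    by rewrite mul0r adde_ge0.
  have [r1|r1] := leP r 1.
    apply: (@le_trans _ _ (f1 r)); last by rewrite leeDl.
    rewrite /f1 patchE mem_set/=; last by rewrite in_itv/= r0.
    rewrite lee_fin (@le_trans _ _ (r `^ (- (1 + 2 * s)) * r ^+ 2))//.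
      by rewrite ler_wpM2l ?powR_ge0// ge_min lexx orbT.
    have -> : r `^ (q1 - 1) = r `^ (- (1 + 2 * s)) * r ^+ 2.
      rewrite -powR_mulrn ?ltW// -powRD; last by rewrite (gt_eqF r0) implybT.
      by congr (_ `^ _); rewrite /q1; ring.
    by [].
  apply: (@le_trans _ _ (f2 r)); last by rewrite leeDr.
  rewrite /f2 patchE mem_set/=; last by rewrite in_itv/= ltW.
  rewrite lee_fin (@le_trans _ _ (r `^ (- (1 + 2 * s))))//.
    by rewrite ler_piMr ?powR_ge0// ge_min lexx.
  have -> : q2 - 1 = - (1 + 2 * s) by rewrite /q2; ring.
  by [].
Qed.

Lemma enorm_ge0 (R : realType) (n : nat) (x : 'rV[R]_n) : 0 <= enorm x.
Proof. exact: sqrtr_ge0. Qed.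

Lemma dot_ge0 (R : realType) (n : nat) (x : 'rV[R]_n) : 0 <= dot x x.
Proof. by apply: sumr_ge0 => i _; rewrite -expr2 sqr_ge0. Qed.

Lemma enorm_sqr (R : realType) (n : nat) (x : 'rV[R]_n) : enorm x ^+ 2 = dot x x.
Proof. by rewrite sqr_sqrtr// dot_ge0. Qed.

Lemma dotC (R : realType) (n : nat) (x y : 'rV[R]_n) : dot x y = dot y x.
Proof. by apply: eq_bigr => i _; rewrite mulrC. Qed.

Lemma dotZl (R : realType) (n : nat) (a : R) (x y : 'rV[R]_n) :
  dot (a *: x) y = a * dot x y.
Proof. by rewrite /dot mulr_sumr; apply: eq_bigr => i _; rewrite mxE mulrA. Qed.

Lemma dotDl (R : realType) (n : nat) (x y z : 'rV[R]_n) :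
  dot (x + y) z = dot x z + dot y z.
Proof. by rewrite /dot -big_split; apply: eq_bigr => i _; rewrite mxE mulrDl. Qed.

Lemma onem_expR_le_min (R : realType) (r : R) :
  1 - expR (- (r ^+ 2 / 4)) <= Num.min 1 (r ^+ 2).
Proof.
rewrite le_min; apply/andP; split; first by rewrite gerBl expR_ge0.
have := expR_ge1Dx (- (r ^+ 2 / 4)); have := sqr_ge0 r; lra.
Qed.

Lemma onem_expR_ge0 (R : realType) (r : R) : 0 <= 1 - expR (- (r ^+ 2 / 4)).
Proof.
by rewrite subr_ge0 -expR0 ler_expR oppr_le0 divr_ge0// sqr_ge0.
Qed.

Lemma measurable_onem_expR (R : realType) :
  measurable_fun [set: R] (fun r => 1 - expR (- (r ^+ 2 / 4))).
Proof.
apply: measurable_funB => //; apply: measurableT_comp => //.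
apply: measurableT_comp => //; exact: measurable_funM.
Qed.

(** By homogeneity the integral is [l^(2s)] times its value at [l = 1]. That
    value is finite, by comparison with [min 1 r^2], and positive, since the
    integrand is positive on [1, 2]; so one can divide by it. *)
Lemma levy_constant (R : realType) (s : R) : 0 < s < 1 ->
  exists2 c : R, 0 < c & forall l : R, 0 <= l ->
    (\int[lebesgue_measure]_r
       (levy_weight s r * (1 - expR (- ((l * r) ^+ 2 / 4))))%:E =
     (l `^ (2 * s) * c)%:E)%E.
Proof.
move=> s01; have /andP[s0 s1] := s01.
pose h (r : R) := 1 - expR (- (r ^+ 2 / 4)).
have h0 r : 0 <= h r by exact: onem_expR_ge0.
have mh : measurable_fun [set: R] h by exact: measurable_onem_expR.
have ml := @measurable_levy_weight R s.
have mf : measurable_fun [set: R] (fun r => (levy_weight s r * h r)%:E).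
  by apply/measurable_EFinP; exact: measurable_funM.
have f0 (r : R) : (0 <= (levy_weight s r * h r)%:E)%E.
  by rewrite lee_fin mulr_ge0 ?levy_weight_ge0.
pose I := (\int[lebesgue_measure]_r (levy_weight s r * h r)%:E)%E.
have I_lty : (I < +oo)%E.
  apply: le_lt_trans (integral_levy_min s01).
  apply: ge0_le_integral => //.
    apply/measurable_EFinP; apply: measurable_funM => //.
    by apply: measurable_minr => //; exact: measurable_funX.
  move=> r _; rewrite lee_fin ler_wpM2l ?levy_weight_ge0//.
  exact: onem_expR_le_min.
have I_gt0 : (0 < I)%E.
  (* Lower bound of the integrand on [1, 2]: the weight decreases and
     [h] increases. *)
  pose m := 2 `^ (- (1 + 2 * s)) * h 1.
  have m0 : 0 < m.
    rewrite mulr_gt0 ?powR_gt0// /h subr_gt0 -[ltRHS]expR0 ltr_expR oppr_lt0.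
    by rewrite expr1n divr_gt0.
  apply: (@lt_le_trans _ _ (\int[lebesgue_measure]_(r in `[1%R, 2%R]) (cst m%:E r))%E).
    rewrite integral_cst//= lebesgue_measure_itv/= lte_fin ltr1n/= -EFinB -EFinM lte_fin.
    by rewrite mulr_gt0// subr_gt0 ltr1n.
  apply: (@le_trans _ _ (\int[lebesgue_measure]_(r in `[1%R, 2%R]) (levy_weight s r * h r)%:E)%E).
    apply: ge0_le_integral => //.
    - by move=> r _; rewrite lee_fin ltW.
    - exact: measurable_funTS.
    - move=> r /=; rewrite in_itv/= => /andP[r1 r2].
      have r0 : 0 < r by exact: lt_le_trans r1.
      rewrite lee_fin /levy_weight r0 ler_pM ?powR_ge0//.
        rewrite !powRN lef_pV2 ?posrE ?powR_gt0//.
        apply: ge0_ler_powR; rewrite ?nnegrE ?(ltW r0)//.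
        by rewrite addr_ge0// mulr_ge0// ltW.
      rewrite /h lerB// ler_expR lerN2 ler_pM2r ?invr_gt0//.
      by rewrite expr1n -(expr1n _ 2) ler_sqr ?nnegrE// ltW.
  by apply: ge0_subset_integral => //.
have I_fin : I \is a fin_num by rewrite ge0_fin_numE// ltW.
exists (fine I); first by rewrite fine_gt0// I_gt0.
move=> l; rewrite le_eqVlt => /predU1P[<-|l0].
  rewrite powR0 ?mulf_neq0 ?gt_eqF// mul0r.
  by apply: integral0_eq => r _; rewrite mul0r expr0n /= mul0r oppr0 expR0 subrr mulr0.
by rewrite (integral_levy_scale s l0 mh h0) EFinM fineK.
Qed.

Lemma integral_gauss_onem_cos (R : realType) (n : nat) (xi : 'rV[R]_n) :
  (\int[leb R n]_v (gaussv v * (1 - cos (dot v xi)))%:E =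
   (Num.sqrt pi ^+ n * (1 - expR (- (dot xi xi / 4))))%:E)%E.
Proof.
under eq_integral do rewrite mulrBr mulr1 EFinB -[dot _ _]addr0.
have i1 : (leb R n).-integrable setT (fun v => (gaussv v)%:E).
  have := @integrable_gaussv_bounded R n (cst 1) _ _.
  under eq_fun do rewrite mulr1.
  by apply => // v; rewrite normr1.
have i2 : (leb R n).-integrable setT (fun v => (gaussv v * cos (dot v xi + 0))%:E).
  apply: integrable_gaussv_bounded; last by move=> v; exact: cos_max.
  apply: (measurableT_comp (continuous_measurable_fun (@continuous_cos R))).
  by apply: measurable_funD => //; exact: measurable_dot.
rewrite integralB//= integral_gaussv gauss_characteristic cos0 mulr1.
by rewrite -EFinB mulrBr mulr1.
Qed.

(** The factor [1 + |v|^2] is paid by half of the Gaussian exponent. *)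
Lemma gaussv_moment (R : realType) (n : nat) (v : 'rV[R]_n) :
  gaussv v * (1 + dot v v) <= 2 * expR (- (2^-1 * dot v v)).
Proof.
rewrite /gaussv (_ : - dot v v = - (2^-1 * dot v v) - 2^-1 * dot v v); last by field.
rewrite expRD; set d := dot v v; set e := expR _.
have e0 : 0 <= e by exact: expR_ge0.
have H : e * (1 + d) <= 2.
  rewrite /e expRN mulrC ler_pdivrMr ?expR_gt0//.
  have := expR_ge1Dx (2^-1 * d); lra.
by rewrite -mulrA [leRHS]mulrC ler_wpM2l.
Qed.

Lemma integral_gauss_half_fin (R : realType) (n : nat) :
  exists2 I : R, 0 <= I &
  (\int[leb R n]_v (2 * expR (- (2^-1 * dot v v)))%:E = I%:E)%E.
Proof.
have E := fineK (integrable_fin_num measurableT (integrable_gauss_half R)).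
set J := fine _ in E.
have J0 : 0 <= J by apply: fine_ge0; apply: integral_ge0 => x _; rewrite lee_fin expR_ge0.
exists (2 * J ^+ n); first by rewrite mulr_ge0// exprn_ge0.
under eq_integral do rewrite EFinM.
rewrite ge0_integralZl//=; last exact: measurable_expR_dotE.
rewrite (@integral_expR_dot R n 2^-1 J) ?EFinM//.
by rewrite E; apply: eq_integral => x _; rewrite mulrC.
Qed.

Lemma min1M_le (R : realType) (a b : R) : 0 <= a -> 0 <= b ->
  Num.min 1 (a * b) <= (1 + b) * Num.min 1 a.
Proof.
move=> a0 b0; rewrite {2}/Num.min; case: ltP => a1.
  by rewrite mulr1 ge_min lerDl b0.
by rewrite ge_min mulrDl mul1r [a * b]mulrC lerDr a0 orbT.
Qed.

(** The jump [y = z.1 *: z.2] has a Gaussian direction [z.2] and a scale [z.1]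
    of density [levy_weight]; its image measure is a multiple of
    [|y|^(-n-2s) dy]. At fixed scale [r] the normalised Gaussian integral of
    [1 - cos] is [1 - exp (- r^2 |xi|^2 / 4)], and [levy_constant] integrates
    this in [r].
    For the bound, [min1M_le] splits [min 1 (r^2 |v|^2 / rho^2)] into a
    Gaussian moment and [min 1 (r^2 / rho^2)], to which scaling applies. *)
Lemma levy_kernel (R : realType) (n : nat) (s : R) : 0 < s < 1 ->
  exists (k : R * 'rV[R]_n -> R) (C : R), [/\
    measurable_fun setT k, (forall z, 0 <= k z), 0 <= C,
    (forall xi, (\int[lebtx R n]_z
       (k z * (1 - cos (dot (z.1 *: z.2) xi)))%:E =
       (enorm xi `^ (2 * s))%:E)%E) &
    (forall rho : R, 0 < rho -> (\int[lebtx R n]_z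
       (k z * Num.min 1 (dot (z.1 *: z.2) (z.1 *: z.2) / rho ^+ 2))%:E <=
       (C * rho `^ (- (2 * s)))%:E)%E)].
Proof.
move=> s01; have [c c0 cE] := levy_constant s01.
have [I I0 IE] := integral_gauss_half_fin R n.
set P : R := Num.sqrt pi ^+ n.
have P0 : 0 < P by rewrite exprn_gt0// sqrtr_gt0 pi_gt0.
pose k (z : R * 'rV[R]_n) := (P * c)^-1 * (levy_weight s z.1 * gaussv z.2).
pose L := (\int[lebesgue_measure]_r (levy_weight s r * Num.min 1 (r ^+ 2))%:E)%E.
have L_ge0 : (0 <= L)%E.
  apply: integral_ge0 => r _; rewrite lee_fin mulr_ge0 ?levy_weight_ge0//.
  by rewrite le_min ler01 sqr_ge0.
have L_fin : L \is a fin_num by rewrite ge0_fin_numE// integral_levy_min.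
have ml := @measurable_levy_weight R s.
have mg := @measurable_gaussv R n.
have Pc0 : 0 <= (P * c)^-1 by rewrite invr_ge0 ltW// mulr_gt0.
have mk : measurable_fun setT k.
  apply: measurable_funM => //; apply: measurable_funM.
    exact: (measurableT_comp ml measurable_fst).
  exact: (measurableT_comp mg measurable_snd).
have k0 z : 0 <= k z by rewrite !mulr_ge0// ?levy_weight_ge0 ?gaussv_ge0.
have my : measurable_fun setT (fun z : measurableTypeR R * 'rV[R]_n => z.1 *: z.2).
  by apply: measurable_rVZ; [exact: measurable_fst|exact: measurable_snd].
exists k, ((P * c)^-1 * I * fine L); split => //.
- by rewrite !mulr_ge0// fine_ge0.
- move=> xi.
  have mc : measurable_fun setT (fun z : measurableTypeR R * 'rV[R]_n => 1 - cos (dot (z.1 *: z.2) xi)).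
    apply: measurable_funB => //.
    apply: (measurableT_comp (continuous_measurable_fun (@continuous_cos R))).
    exact: measurable_dot.
  have cos0 x : 0 <= 1 - cos x :> R by rewrite subr_ge0 cos_le1.
  rewrite /lebtx fubini_tonelli1; last 2 first.
  - by apply/measurable_EFinP; exact: measurable_funM.
  - by move=> z; rewrite lee_fin mulr_ge0.
  rewrite /fubini_F /=.
  under eq_integral => r _.
    under eq_integral => v _ do
      rewrite /k /= dotZl dotC -dotZl dotC -!mulrA mulrA EFinM.
    rewrite ge0_integralZl//=; last 3 first.
    - apply/measurable_EFinP; apply: measurable_funM => //.
      apply: measurable_funB => //.
      apply: (measurableT_comp (continuous_measurable_fun (@continuous_cos R))).
      exact: measurable_dot.
    - by move=> v _; rewrite lee_fin mulr_ge0 ?gaussv_ge0.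
    - by rewrite lee_fin mulr_ge0 ?levy_weight_ge0.
    rewrite integral_gauss_onem_cos -EFinM dotZl dotC dotZl mulrA -expr2.
    rewrite -enorm_sqr -exprMn [r * _]mulrC.
    rewrite mulrACA EFinM.
    over.
  rewrite /= ge0_integralZl//=; last 3 first.
  - apply/measurable_EFinP; apply: measurable_funM => //.
    apply: (measurableT_comp (@measurable_onem_expR R)).
    exact: measurable_funM.
  - by move=> r _; rewrite lee_fin mulr_ge0 ?levy_weight_ge0 ?onem_expR_ge0.
  - by rewrite lee_fin mulr_ge0// ltW.
  rewrite cE ?enorm_ge0// -EFinM; congr EFin.
  have cancel (p e : R) : 0 < p -> (p * c)^-1 * p * (e * c) = e.
    by move=> p0; field; rewrite !gt_eqF.
  exact: cancel.
- move=> rho rho0.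
  pose F (z : R * 'rV[R]_n) := (P * c)^-1 * (levy_weight s z.1 * Num.min 1 ((rho^-1 * z.1) ^+ 2) *
    (2 * expR (- (2^-1 * dot z.2 z.2)))).
  have mm (f : measurableTypeR R -> R) : measurable_fun setT f -> measurable_fun setT (fun r => Num.min 1 (f r)).
    by move=> mf; exact: measurable_minr.
  have m1 : measurable_fun [set: R] (fun r => levy_weight s r * Num.min 1 ((rho^-1 * r) ^+ 2)).
    apply: measurable_funM => //; apply: mm; apply: measurable_funX.
    exact: measurable_funM.
  have m2 : measurable_fun setT (fun v : 'rV[R]_n => 2 * expR (- (2^-1 * dot v v))).
    by apply: measurable_funM => //; exact: measurable_expR_dot.
  have mF : measurable_fun setT (EFin \o F).
    apply/measurable_EFinP; apply: measurable_funM => //; apply: measurable_funM.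
      exact: (measurableT_comp m1 measurable_fst).
    exact: (measurableT_comp m2 measurable_snd).
  have min0 x : 0 <= x -> 0 <= Num.min 1 x :> R by move=> x0; rewrite le_min ler01.
  have F0 z : (0 <= (EFin \o F) z)%E.
    rewrite lee_fin !mulr_ge0 ?levy_weight_ge0 ?expR_ge0//.
    by rewrite min0// sqr_ge0.
  apply: (@le_trans _ _ (\int[lebtx R n]_z (EFin \o F) z)%E).
    apply: ge0_le_integral => //.
    - by move=> z _; rewrite lee_fin mulr_ge0// min0// divr_ge0 ?dot_ge0 ?sqr_ge0.
    - apply/measurable_EFinP; apply: measurable_funM => //.
      apply: measurable_minr => //; apply: measurable_funM => //.
      exact: measurable_dot.
    - move=> z _; rewrite lee_fin /k /F -!mulrA ler_wpM2l// ler_wpM2l ?levy_weight_ge0//.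
      have -> : dot (z.1 *: z.2) (z.1 *: z.2) / rho ^+ 2 = (rho^-1 * z.1) ^+ 2 * dot z.2 z.2.
        by rewrite dotZl dotC dotZl exprMn exprVn; ring.
      apply: (@le_trans _ _ (gaussv z.2 * ((1 + dot z.2 z.2) * Num.min 1 ((rho^-1 * z.1) ^+ 2)))).
        by rewrite ler_wpM2l ?gaussv_ge0// min1M_le ?sqr_ge0 ?dot_ge0.
      by rewrite mulrA [leRHS]mulrC ler_wpM2r ?min0 ?sqr_ge0 ?gaussv_moment.
  rewrite /lebtx fubini_tonelli1// /fubini_F /=.
  under eq_integral => r _.
    under eq_integral => v _ do rewrite /F /= (mulrA (P * c)^-1) EFinM.
    rewrite ge0_integralZl//=; last 2 first.
    - exact/measurable_EFinP.
    - by rewrite lee_fin !mulr_ge0 ?levy_weight_ge0 ?min0 ?sqr_ge0.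
    rewrite IE -EFinM mulrAC EFinM.
    over.
  rewrite /= ge0_integralZl//=; last 3 first.
  - exact/measurable_EFinP.
  - by move=> r _; rewrite lee_fin mulr_ge0 ?levy_weight_ge0 ?min0 ?sqr_ge0.
  - by rewrite lee_fin mulr_ge0.
  rewrite (@integral_levy_scale _ s rho^-1 (fun r => Num.min 1 (r ^+ 2))) ?invr_gt0//; last 2 first.
  - by apply: mm; exact: measurable_funX.
  - by move=> r; rewrite min0 ?sqr_ge0.
  rewrite -/L -(fineK L_fin) -!EFinM lee_fin.
  have -> : rho^-1 `^ (2 * s) = rho `^ (- (2 * s)).
    by rewrite -(powR_inv1 (ltW rho0)) -powRrM mulN1r.
  by rewrite /= [X in _ * X <= _]mulrC mulrA.
Qed.

(** * Symmetric differences and their averages *)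

Lemma integral_leb_translate (R : realType) (n : nat) (y : 'rV[R]_n)
    (f : 'rV[R]_n -> \bar R) :
  measurable_fun setT f ->
  (\int[leb R n]_x f (x + y)%R = \int[leb R n]_x f x)%E.
Proof.
move=> mf; rewrite [LHS]integralE [RHS]integralE; congr (_ - _)%E.
  rewrite -(@ge0_integral_leb_translate _ _ y (f^\+)%E)//.
    by apply: eq_integral => x _; rewrite !funeposE.
  by apply: measurable_funepos.
rewrite -(@ge0_integral_leb_translate _ _ y (f^\-)%E)//.
  by apply: eq_integral => x _; rewrite !funenegE.
by apply: measurable_funeneg.
Qed.

Lemma measurable_translate (R : realType) (n : nat) (y : 'rV[R]_n) :
  measurable_fun setT (fun x : 'rV[R]_n => x + y).
Proof. exact: measurable_rVD. Qed.

Lemma integrable_leb_translate (R : realType) (n : nat) (y : 'rV[R]_n)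
    (f : 'rV[R]_n -> R) :
  (leb R n).-integrable setT (EFin \o f) ->
  (leb R n).-integrable setT (fun x => (f (x + y))%:E).
Proof.
move=> /integrableP[mf intf].
apply/integrableP; split.
  exact: (measurableT_comp mf (measurable_translate y)).
rewrite (@ge0_integral_leb_translate _ _ y (fun x => `|(f x)%:E|)%E)//.
exact: measurableT_comp mf.
Qed.

(** Symmetric difference: minus one half of the second difference of [f] at
    [x] with step [y], positive at a maximum like the fractional Laplacian. *)
Definition sdiff (R : realType) (n : nat) (f : 'rV[R]_n -> R)
    (x y : 'rV[R]_n) : R :=
  f x - 2^-1 * (f (x + y) + f (x - y)).

Lemma integrable_sdiff (R : realType) (n : nat) (f : 'rV[R]_n -> R) y :
  (leb R n).-integrable setT (EFin \o f) ->
  (leb R n).-integrable setT (fun x => (sdiff f x y)%:E).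
Proof.
move=> intf.
have i1 := integrable_leb_translate y intf.
have i2 := integrable_leb_translate (- y) intf.
have i3 := integrableB measurableT intf (integrableZl measurableT 2^-1 (integrableD measurableT i1 i2)).
apply: eq_integrable i3 => // x _.
Qed.

Lemma integrable_cos (R : realType) (n : nat) (f : 'rV[R]_n -> R)
    (xi : 'rV[R]_n) (c : R) :
  (leb R n).-integrable setT (EFin \o f) ->
  (leb R n).-integrable setT (fun x => (f x * cos (dot x xi + c))%:E).
Proof.
move=> intf; have /integrableP[/measurable_EFinP mf _] := intf.
apply: (le_integrable measurableT _ _ intf).
  apply/measurable_EFinP; apply: measurable_funM => //.
  apply: (measurableT_comp (continuous_measurable_fun (@continuous_cos R))).
  by apply: measurable_funD => //; exact: measurable_dot.
by move=> x _; rewrite !abse_EFin lee_fin normrM ler_piMr// cos_max.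
Qed.

(** Translating [f] by [y] or [- y] shifts the phase by [dot y xi] with
    opposite signs, and the two shifted cosines average to
    [cos (dot y xi)] times the original one. *)
Lemma integral_sdiff_cos (R : realType) (n : nat) (f : 'rV[R]_n -> R)
    (y xi : 'rV[R]_n) (c : R) :
  (leb R n).-integrable setT (EFin \o f) ->
  \int[leb R n]_x (sdiff f x y * cos (dot x xi + c)) =
  (1 - cos (dot y xi)) * \int[leb R n]_x (f x * cos (dot x xi + c)).
Proof.
move=> intf; have /integrableP[/measurable_EFinP mf _] := intf.
have T (z : 'rV[R]_n) : \int[leb R n]_x (f (x + z) * cos (dot x xi + c)) =
    \int[leb R n]_x (f x * cos (dot x xi + (c - dot z xi))).
  rewrite /Rintegral; congr fine.
  rewrite -(@integral_leb_translate _ _ z (fun x => (f x * cos (dot x xi + (c - dot z xi)))%:E)).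
    apply: eq_integral => x _; rewrite dotDl; congr (_ * cos _)%:E; ring.
  have := integrable_cos xi (c - dot z xi) intf.
  exact: measurable_int.
have it z : (leb R n).-integrable setT (fun x => (f (x + z) * cos (dot x xi + c))%:E).
  exact: integrable_cos (integrable_leb_translate z intf).
have ic := integrable_cos xi _ intf.
transitivity (\int[leb R n]_x (f x * cos (dot x xi + c)
   - 2^-1 * (f (x + y) * cos (dot x xi + c) + f (x + - y) * cos (dot x xi + c)))).
  by apply: eq_Rintegral => x _; rewrite /sdiff; ring.
have iD := integrableD measurableT (it y) (it (- y)).
rewrite RintegralB//; last 2 first.
- exact: ic.
- exact: (integrableZl measurableT 2^-1 iD).
pose A z x := f x * cos (dot x xi + (c - dot z xi)).
have iA z : (leb R n).-integrable setT (EFin \o A z) by exact: ic.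
have iA2 := integrableD measurableT (iA y) (iA (- y)).
rewrite (@RintegralZl _ _ _ (leb R n) _ _ _ measurableT iD).
rewrite (@RintegralD _ _ _ (leb R n) _ _ _ measurableT (it y) (it (- y))) !T.
rewrite -(@RintegralD _ _ _ (leb R n) _ (A y) (A (- y)) measurableT (iA _) (iA _)).
rewrite mulrBl mul1r; congr (_ - _).
rewrite -(@RintegralZl _ _ _ (leb R n) _ _ _ measurableT iA2).
rewrite -RintegralZl//; last exact: ic.
apply: eq_Rintegral => x _.
rewrite /A; have dN : dot (- y) xi = - dot y xi by rewrite -scaleN1r dotZl mulN1r.
rewrite dN opprK.
rewrite (_ : dot x xi + (c - dot y xi) = (dot x xi + c) - dot y xi); last by ring.
rewrite (_ : dot x xi + (c + dot y xi) = (dot x xi + c) + dot y xi); last by ring.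
by set t := (dot x xi + c); rewrite cosB cosD; field.
Qed.

(** The symmetric difference has zero integral ([integral_sdiff_cos] at
    frequency 0), hence its positive and negative parts have equal
    integrals: a bound from above on the function bounds its L^1 norm. *)
Lemma integral_abs_sdiff (R : realType) (n : nat) (f b : 'rV[R]_n -> R)
    (y : 'rV[R]_n) (m : R) :
  (leb R n).-integrable setT (EFin \o f) ->
  measurable_fun setT b -> (forall x, 0 <= b x) -> 0 <= m ->
  (forall x, sdiff f x y <= b x * m) ->
  (\int[leb R n]_x `|(sdiff f x y)%:E| <=
   (2 * m)%:E * \int[leb R n]_x (b x)%:E)%E.
Proof.
move=> intf mb b0 m0 le.
have iS := integrable_sdiff y intf.
have /integrableP[mS _] := iS.
(* The frequency is 0, where the cosine is 1. *)
have S0 : (\int[leb R n]_x (sdiff f x y)%:E = 0)%E.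
  have := integral_sdiff_cos y 0 0 intf.
  have dot0 (z : 'rV[R]_n) : dot z 0 = 0.
    by rewrite /dot big1// => i _; rewrite mxE mulr0.
  rewrite dot0 cos0 subrr mul0r.
  under eq_Rintegral do rewrite dot0 addr0 cos0 mulr1.
  rewrite /Rintegral => S0.
  by rewrite -[LHS]fineK ?S0// integrable_fin_num.
have pos_fin : (\int[leb R n]_x (fun x => (sdiff f x y)%:E)^\+ x)%E \is a fin_num.
  exact: integrable_pos_fin_num.
have E : (\int[leb R n]_x (fun x => (sdiff f x y)%:E)^\- x =
          \int[leb R n]_x (fun x => (sdiff f x y)%:E)^\+ x)%E.
  move: S0; rewrite integralE => /eqP.
  rewrite sube_eq ?add0e => [/eqP -> //|//|].
  by rewrite fin_num_adde_defr.
rewrite -[X in (X <= _)%E]/(\int[leb R n]_x (abse \o (fun x => (sdiff f x y)%:E)) x)%E fune_abse.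
rewrite ge0_integralD//=; last 2 first.
- exact: measurable_funepos.
- exact: measurable_funeneg.
rewrite E -mule2n -mule_natl EFinM -muleA.
rewrite lee_pmul2l// -ge0_integralZl//=; last first.
- by move=> x _; rewrite lee_fin.
- by apply/measurable_EFinP.
apply: ge0_le_integral => //.
- exact: measurable_funepos.
- by apply/measurable_EFinP; apply: measurable_funM.
- move=> x _; by rewrite funeposE ge_max -EFinM !lee_fin mulrC le mulr_ge0.
Qed.

Definition levy_op (R : realType) (n : nat) (k : R * 'rV[R]_n -> R)
    (f : 'rV[R]_n -> R) (x : 'rV[R]_n) : R :=
  \int[lebtx R n]_z (k z * sdiff f x (z.1 *: z.2)).

Section levy_operator.
Variables (R : realType) (n : nat) (s rho C : R).
Variables (k : R * 'rV[R]_n -> R) (f b : 'rV[R]_n -> R).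
Let m (y : 'rV[R]_n) : R := Num.min 1 (dot y y / rho ^+ 2).
Hypothesis mk : measurable_fun setT k.
Hypothesis k0 : forall z, 0 <= k z.
Hypothesis kE : forall xi, (\int[lebtx R n]_z
  (k z * (1 - cos (dot (z.1 *: z.2) xi)))%:E = (enorm xi `^ (2 * s))%:E)%E.
Hypothesis kmin : (\int[lebtx R n]_z (k z * m (z.1 *: z.2))%:E <= C%:E)%E.
Hypothesis intf : (leb R n).-integrable setT (EFin \o f).
Hypothesis intb : (leb R n).-integrable setT (EFin \o b).
Hypothesis b0 : forall x, 0 <= b x.
Hypothesis sdiff_le : forall x y, sdiff f x y <= b x * m y.

Let mf : measurable_fun setT f.
Proof. by have /integrableP[/measurable_EFinP] := intf. Qed.

Let mb : measurable_fun setT b.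
Proof. by have /integrableP[/measurable_EFinP] := intb. Qed.

Let m_ge0 y : 0 <= m y.
Proof. by rewrite le_min ler01 divr_ge0 ?dot_ge0 ?sqr_ge0. Qed.

Let my : measurable_fun setT (fun z : measurableTypeR R * 'rV[R]_n => z.1 *: z.2).
Proof. by apply: measurable_rVZ; [exact: measurable_fst|exact: measurable_snd]. Qed.

Let mm : measurable_fun setT m.
Proof.
by apply: measurable_minr => //; apply: measurable_funM => //; exact: measurable_dot.
Qed.

Let mkm : measurable_fun setT
  (fun z : measurableTypeR R * 'rV[R]_n => k z * m (z.1 *: z.2)).
Proof. by apply: measurable_funM => //; exact: (measurableT_comp mm my). Qed.

Let h c xi (u : 'rV[R]_n * (measurableTypeR R * 'rV[R]_n)) : \bar R :=
  (k u.2 * sdiff f u.1 (u.2.1 *: u.2.2) * cos (dot u.1 xi + c))%:E.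

Let mh c xi : measurable_fun setT (h c xi).
Proof.
have my2 : measurable_fun setT (fun u : 'rV[R]_n * (measurableTypeR R * 'rV[R]_n) => u.2.1 *: u.2.2).
  exact: (measurableT_comp my measurable_snd).
have m1 : measurable_fun setT (fun u : 'rV[R]_n * (measurableTypeR R * 'rV[R]_n) => u.1).
  exact: measurable_fst.
apply/measurable_EFinP; apply: measurable_funM; last first.
  apply: (measurableT_comp (continuous_measurable_fun (@continuous_cos R))).
  by apply: measurable_funD => //; exact: measurable_dot.
apply: measurable_funM; first exact: (measurableT_comp mk measurable_snd).
apply: measurable_funB; first exact: (measurableT_comp mf m1).
apply: measurable_funM => //; apply: measurable_funD.
  by apply: (measurableT_comp mf); exact: measurable_rVD.
apply: (measurableT_comp mf).
under eq_fun do rewrite -scaleN1r.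
apply: measurable_rVD => //; exact: measurable_rVZ.
Qed.

Let inth c xi : (leb R n \x lebtx R n)%E.-integrable setT (h c xi).
Proof.
apply/(integrable21ltyP _ _ (mh c xi)).
pose B := (\int[leb R n]_x (b x)%:E)%E.
have B0 : (0 <= B)%E by apply: integral_ge0 => x _; rewrite lee_fin.
have Bfin : B \is a fin_num by exact: (integrable_fin_num measurableT intb).
have mB : measurable_fun setT (fun z : measurableTypeR R * 'rV[R]_n =>
    ((2 * fine B) * (k z * m (z.1 *: z.2)))%:E).
  by apply/measurable_EFinP; exact: measurable_funM.
apply: (@le_lt_trans _ _ (\int[lebtx R n]_z
    ((2 * fine B) * (k z * m (z.1 *: z.2)))%:E)%E).
  apply: ge0_le_integral => //.
  - by move=> z _; apply: integral_ge0.
  - apply: (@measurable_fun_fubini_tonelli_G _ _ _ _ _ (leb R n) (fun u => `|h c xi u|%E)) => //.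
    exact: measurableT_comp (mh c xi).
  - move=> z _.
    apply: (@le_trans _ _ (\int[leb R n]_x ((k z)%:E * `|(sdiff f x (z.1 *: z.2))%:E|))%E).
      have mS := measurable_int _ (integrable_sdiff (z.1 *: z.2) intf).
      apply: ge0_le_integral => //.
      + apply: measurableT_comp => //.
        exact: (measurableT_comp (mh c xi) (measurable_pair2 z)).
      + by apply: measurable_funeM; exact: measurableT_comp.
      + move=> x _; rewrite /h /= -EFinM lee_fin !normrM (ger0_norm (k0 z)).
        by rewrite ler_piMr ?mulr_ge0// cos_max.
    have mS := measurable_int _ (integrable_sdiff (z.1 *: z.2) intf).
    rewrite ge0_integralZl//; last 2 first.
    + exact: (measurableT_comp _ mS).
    + by rewrite lee_fin.
    rewrite (_ : 2 * fine B * (k z * m (z.1 *: z.2)) =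
      k z * (2 * m (z.1 *: z.2) * fine B)); last by ring.
    rewrite EFinM lee_wpmul2l ?lee_fin// EFinM fineK//.
    exact: integral_abs_sdiff.
under eq_integral do rewrite EFinM.
rewrite ge0_integralZl//=; last 3 first.
- exact/measurable_EFinP.
- by move=> z _; rewrite lee_fin mulr_ge0.
- by rewrite lee_fin mulr_ge0// fine_ge0.
apply: (@le_lt_trans _ _ ((2 * fine B)%:E * C%:E)%E); last by rewrite -EFinM ltry.
by rewrite lee_wpmul2l// lee_fin mulr_ge0// fine_ge0.
Qed.

Let G x : \bar R := (\int[lebtx R n]_z (k z * sdiff f x (z.1 *: z.2))%:E)%E.

Let intG : (leb R n).-integrable setT G.
Proof.
have := integrable_fubini_F (inth 0 0); rewrite /fubini_F /=; apply: eq_integrable => // x _.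
apply: eq_integral => z _; rewrite /h /= (_ : dot x 0 = 0) ?addr0 ?cos0 ?mulr1//.
by rewrite /dot big1// => i _; rewrite mxE mulr0.
Qed.

Let measurable_levy_op : measurable_fun setT (levy_op k f).
Proof.
exact: (measurableT_comp (fine_measurable measurableT) (measurable_int _ intG)).
Qed.

Lemma integrable_levy_op : (leb R n).-integrable setT (EFin \o levy_op k f).
Proof.
apply: (le_integrable measurableT _ _ intG); first by apply/measurable_EFinP; exact: measurable_levy_op.
move=> x _; rewrite /levy_op /Rintegral /= -/(G x).
by case: (G x) => [r| |] //=; rewrite ?normr0 ?leey.
Qed.

(** The kernel times the symmetric difference is integrable on the product
    space, so the two integrations can be exchanged; the inner one over [x]
    multiplies by [1 - cos (dot y xi)], whose average is the symbol. *)
Lemma levy_op_cos xi c :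
  \int[leb R n]_x (levy_op k f x * cos (dot x xi + c)) =
  enorm xi `^ (2 * s) * \int[leb R n]_x (f x * cos (dot x xi + c)).
Proof.
rewrite [LHS]/Rintegral.
set A := \int[leb R n]_x (f x * cos (dot x xi + c)).
have mcos : measurable_fun setT (fun x : 'rV[R]_n => cos (dot x xi + c)).
  apply: (measurableT_comp (continuous_measurable_fun (@continuous_cos R))).
  by apply: measurable_funD => //; exact: measurable_dot.
have E1 : (\int[leb R n]_x (levy_op k f x * cos (dot x xi + c))%:E =
    \int[leb R n]_x \int[lebtx R n]_z h c xi (x, z))%E.
  apply: ae_eq_integral => //.
  - by apply/measurable_EFinP; apply: measurable_funM => //; exact: measurable_levy_op.
  - exact: (measurable_int _ (integrable_fubini_F (inth c xi))).
  (* [levy_op] is a real-valued integral, equal to the extended-real one only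
     where the latter is finite, that is for almost every [x]. *)
  have := ae_integrable1 (inth 0 0).
  apply: filterS => x ix _.
  have {}ix : (lebtx R n).-integrable setT (fun z => (k z * sdiff f x (z.1 *: z.2))%:E).
    move: ix; apply: eq_integrable => // z _; rewrite /h /= (_ : dot x 0 = 0) ?addr0 ?cos0 ?mulr1//.
    by rewrite /dot big1// => i _; rewrite mxE mulr0.
  rewrite /h /=; under [RHS]eq_integral do rewrite EFinM.
  rewrite integralZr// EFinM /levy_op /Rintegral fineK//.
  exact: integrable_fin_num.
rewrite E1 (Fubini (inth c xi)).
have inner z : (\int[leb R n]_x h c xi (x, z) =
    A%:E * (k z * (1 - cos (dot (z.1 *: z.2) xi)))%:E)%E.
  rewrite /h /=.
  under eq_integral do rewrite -mulrA EFinM.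
  have iS := integrable_cos xi c (integrable_sdiff (z.1 *: z.2) intf).
  rewrite integralZl// -[X in (_ * X)%E]fineK; last exact: integrable_fin_num.
  have := integral_sdiff_cos (z.1 *: z.2) xi c intf; rewrite [in X in X -> _]/Rintegral => ->.
  by rewrite -[fine _]/A -EFinM mulrA mulrC EFinM.
under eq_integral do rewrite inner.
rewrite integralZl//; last first.
  apply/integrableP; split.
    apply/measurable_EFinP; apply: measurable_funM => //; apply: measurable_funB => //.
    apply: (measurableT_comp (continuous_measurable_fun (@continuous_cos R))).
    exact: measurable_dot.
  under eq_integral do rewrite /= ger0_norm ?mulr_ge0 ?subr_ge0 ?cos_le1//.
  by rewrite kE ltry.
by rewrite kE /= mulrC.
Qed.

(** The real part of the Fourier transform is [levy_op_cos] with phase 0, and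
    the imaginary part is the same identity with phase [pi / 2]. *)
Lemma fraclap_levy_op : fraclap s f (levy_op k f).
Proof.
split => //; first exact: integrable_levy_op.
move=> xi.
have Ec : \int[leb R n]_x (levy_op k f x * cos (dot x xi)) =
    enorm xi `^ (2 * s) * \int[leb R n]_x (f x * cos (dot x xi)).
  have := levy_op_cos xi 0.
  under eq_Rintegral do rewrite addr0.
  by under [in X in _ = X -> _]eq_Rintegral do rewrite addr0.
have Nsin (u : 'rV[R]_n -> R) : (leb R n).-integrable setT (EFin \o u) ->
    \int[leb R n]_x (u x * cos (dot x xi + pi / 2)) =
    - \int[leb R n]_x (u x * sin (dot x xi)).
  move=> iu.
  have icu := integrable_cos xi (pi / 2) iu.
  rewrite -[LHS]opprK -[X in - X]mulN1r.
  rewrite -(@RintegralZl _ _ _ (leb R n) setT _ (-1) measurableT icu); congr (- _).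
  by apply: eq_Rintegral => x _; rewrite cosDpihalf mulN1r mulrN opprK.
have Es : \int[leb R n]_x (levy_op k f x * sin (dot x xi)) =
    enorm xi `^ (2 * s) * \int[leb R n]_x (f x * sin (dot x xi)).
  have := levy_op_cos xi (pi / 2).
  rewrite !Nsin//; last exact: integrable_levy_op.
  by rewrite mulrN => /oppr_inj.
apply/eqP; rewrite /fourier Ec Es eq_complex /= !mul0r subr0 addr0.
by rewrite mulrN !eqxx.
Qed.

(** Only the one-sided bound on the symmetric differences is used, through
    the positive part of the integrand; hence the estimate holds at every
    [x], including those where the negative part has infinite integral and
    [levy_op] is 0 by convention. *)
Lemma levy_op_le x : levy_op k f x <= b x * C.
Proof.
have C0 : 0 <= C.
  rewrite -lee_fin; apply: le_trans kmin.
  by apply: integral_ge0 => z _; rewrite lee_fin mulr_ge0.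
have mk1 : measurable_fun setT
    (fun z : measurableTypeR R * 'rV[R]_n => (k z * sdiff f x (z.1 *: z.2))%:E).
  apply/measurable_EFinP; apply: measurable_funM => //.
  apply: measurable_funB => //; apply: measurable_funM => //; apply: measurable_funD.
    by apply: (measurableT_comp mf); exact: measurable_rVD.
  apply: (measurableT_comp mf).
  under eq_fun do rewrite -scaleN1r.
  by apply: measurable_rVD => //; exact: measurable_rVZ.
have : (\int[lebtx R n]_z (k z * sdiff f x (z.1 *: z.2))%:E <= (b x * C)%:E)%E.
  rewrite integralE; apply: (@le_trans _ _ (\int[lebtx R n]_z
      (fun z => (k z * sdiff f x (z.1 *: z.2))%:E)^\+ z)%E).
    by rewrite geeDl// oppe_le0 integral_ge0.
  apply: (@le_trans _ _ (\int[lebtx R n]_z ((b x)%:E * (k z * m (z.1 *: z.2))%:E))%E).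
    apply: ge0_le_integral => //.
    - exact: measurable_funepos.
    - by apply: measurable_funeM; exact/measurable_EFinP.
    - move=> z _; rewrite funeposE ge_max -EFinM !lee_fin; apply/andP; split.
        by rewrite mulrCA ler_wpM2l.
      by rewrite !mulr_ge0.
  rewrite ge0_integralZl//; last 3 first.
  - exact/measurable_EFinP.
  - by move=> z _; rewrite lee_fin mulr_ge0.
  - by rewrite lee_fin.
  by rewrite EFinM lee_wpmul2l// lee_fin.
rewrite /levy_op /Rintegral; case: (integral _ _ _) => [r| |] //= _.
by rewrite mulr_ge0.
Qed.

End levy_operator.

(** * The fractional Laplacian of powers of a cutoff *)

Definition cutoff (R : realType) (n : nat) (r : R) (x : 'rV[R]_n) : R :=
  Num.max 0 (1 - dot x x / r ^+ 2).

Lemma cutoff_ge0 (R : realType) (n : nat) (r : R) (x : 'rV[R]_n) : 0 <= cutoff r x.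
Proof. by rewrite le_max lexx. Qed.

Lemma cutoff_le1 (R : realType) (n : nat) (r : R) (x : 'rV[R]_n) : cutoff r x <= 1.
Proof. by rewrite ge_max ler01 gerBl divr_ge0 ?dot_ge0 ?sqr_ge0. Qed.

Lemma measurable_cutoff (R : realType) (n : nat) (r : R) :
  measurable_fun setT (@cutoff R n r).
Proof.
apply: measurable_maxr => //; apply: measurable_funB => //.
by apply: measurable_funM => //; exact: measurable_dot.
Qed.

Lemma cutoff_outside (R : realType) (n : nat) (r : R) (x : 'rV[R]_n) :
  0 < r -> r < enorm x -> cutoff r x = 0.
Proof.
move=> r0 rx; apply/max_idPl; rewrite subr_le0 ler_pdivlMr ?exprn_gt0// mul1r.
rewrite -enorm_sqr ler_pXn2r ?nnegrE ?enorm_ge0 ?(ltW r0)//; exact: ltW.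
Qed.

(** The tangent of [v |-> v^(n+1)] at [a] lies below its graph. *)
Lemma exprn_convex (R : realType) (n : nat) (a b : R) : 0 <= a -> 0 <= b ->
  a ^+ n.+1 - b ^+ n.+1 <= n.+1%:R * a ^+ n * (a - b).
Proof.
move=> a0 b0; elim: n => [|n IH]; first by rewrite !expr1 expr0 !mul1r.
have H : 0 <= (a ^+ n.+1 - b ^+ n.+1) * (a - b).
  have [ab|/ltW ab] := leP a b.
    by rewrite mulr_le0// subr_le0// lerXn2r.
  by rewrite mulr_ge0// subr_ge0// lerXn2r.
have := ler_wpM2l a0 IH.
rewrite -[n.+2%:R]natr1 (exprS a n.+1) (exprS b n.+1).
move: H; rewrite (exprS a n); set A := a ^+ n; set B := b ^+ n.+1; set M := n.+1%:R.
lra.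
Qed.

(** By convexity the symmetric difference of a power is at most the derivative
    of the power times the symmetric difference of [cutoff r]. Where the cutoff
    is positive it agrees with a quadratic function, whose symmetric
    difference is [|y|^2 / r^2], and elsewhere it lies above it. *)
Lemma sdiff_cutoff (R : realType) (n : nat) (r : R) (k : nat) (x y : 'rV[R]_n) :
  sdiff (fun x => cutoff r x ^+ k.+1) x y <=
  k.+1%:R * cutoff r x ^+ k * Num.min 1 (dot y y / r ^+ 2).
Proof.
have m0 : 0 <= Num.min 1 (dot y y / r ^+ 2).
  by rewrite le_min ler01 divr_ge0 ?dot_ge0 ?sqr_ge0.
have b0 := @cutoff_ge0 R n r.
(* Outside the ball the right-hand side is not negative, while the symmetric
   difference of a nonnegative function is not positive at its zeros. *)
have [x0|x0] := leP (1 - dot x x / r ^+ 2) 0.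
  have -> : cutoff r x = 0 by apply/max_idPl.
  rewrite /sdiff; have -> : cutoff r x = 0 by apply/max_idPl.
  rewrite [X in X - _]expr0n /= sub0r.
  apply: (@le_trans _ _ 0); last by rewrite !mulr_ge0// exprn_ge0.
  by rewrite oppr_le0 mulr_ge0// addr_ge0// exprn_ge0.
have c1 := exprn_convex k (b0 x) (b0 (x + y)).
have c2 := exprn_convex k (b0 x) (b0 (x - y)).
have c3 : 0 <= k.+1%:R * cutoff r x ^+ k by rewrite mulr_ge0// exprn_ge0.
have c4 : cutoff r x - 2^-1 * (cutoff r (x + y) + cutoff r (x - y)) <= Num.min 1 (dot y y / r ^+ 2).
  rewrite le_min; apply/andP; split.
    have := b0 (x + y); have := b0 (x - y); have := @cutoff_le1 R n r x; lra.
  have : 1 - dot (x + y) (x + y) / r ^+ 2 <= cutoff r (x + y) by rewrite le_max lexx orbT.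
  have : 1 - dot (x - y) (x - y) / r ^+ 2 <= cutoff r (x - y) by rewrite le_max lexx orbT.
  have -> : cutoff r x = 1 - dot x x / r ^+ 2 by apply/max_idPr; exact: ltW.
  have E : dot (x + y) (x + y) + dot (x - y) (x - y) = 2 * dot x x + 2 * dot y y.
    by rewrite /dot -big_split /= !mulr_sumr -big_split /=; apply: eq_bigr => i _; rewrite !mxE; ring.
  have {}E : dot (x + y) (x + y) / r ^+ 2 + dot (x - y) (x - y) / r ^+ 2 =
    2 * (dot x x / r ^+ 2) + 2 * (dot y y / r ^+ 2).
    by rewrite -mulrDl E mulrDl !mulrA.
  lra.
apply: le_trans (ler_wpM2l c3 c4).
rewrite /sdiff; move: c1 c2; set A := _ * cutoff r x ^+ k; lra.
Qed.

(** A Gaussian of width [r] dominates the indicator of the ball of radius [r],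
    up to the factor [e]. Its integral is explicit, which spares computing
    volumes of balls. *)
Lemma gauss_scaled_ge1 (R : realType) (n : nat) (r : R) (x : 'rV[R]_n) :
  0 < r -> enorm x <= r -> 1 <= expR 1 * expR (- (r ^- 2 * dot x x)).
Proof.
move=> r0 xr; rewrite -expRD -[leLHS]expR0 ler_expR subr_ge0 mulrC.
rewrite ler_pdivrMr ?exprn_gt0// mul1r -enorm_sqr.
by rewrite lerXn2r ?nnegrE ?enorm_ge0// ltW.
Qed.

Lemma integral_gauss_scaled (R : realType) (n : nat) (r : R) : 0 < r ->
  (\int[leb R n]_x (expR 1 * expR (- (r ^- 2 * dot x x)))%:E =
   (expR 1 * (r * Num.sqrt pi) ^+ n)%:E)%E.
Proof.
move=> r0; under eq_integral do rewrite EFinM.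
rewrite ge0_integralZl//=; last exact: measurable_expR_dotE.
rewrite (@integral_expR_dot R n _ (r * Num.sqrt pi)) ?EFinM//.
  by rewrite mulr_ge0 ?sqrtr_ge0// ltW.
have r1 : 0 < r^-1 by rewrite invr_gt0.
have mg : measurable_fun [set: R] (fun x => (gauss_fun x)%:E).
  by apply/measurable_EFinP; exact: measurable_gauss_fun.
have g0 (x : R) : (0 <= (gauss_fun x)%:E)%E by rewrite lee_fin gauss_fun_ge0.
have := ge0_integral_affine 0 r1 mg g0.
rewrite integralT_gauss invrK -EFinM => E; rewrite -{}E.
by apply: eq_integral => x _; rewrite /gauss_fun addr0 exprMn exprVn.
Qed.

Lemma cutoffX_le_gauss (R : realType) (n : nat) (r : R) (k : nat) (x : 'rV[R]_n) :
  0 < r -> cutoff r x ^+ k.+1 <= expR 1 * expR (- (r ^- 2 * dot x x)).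
Proof.
move=> r0; have [xr|xr] := leP (enorm x) r.
  by apply: le_trans (gauss_scaled_ge1 r0 xr); rewrite exprn_ile1 ?cutoff_ge0 ?cutoff_le1.
by rewrite cutoff_outside// expr0n /= mulr_ge0 ?expR_ge0.
Qed.

Lemma integrable_gauss_scaled (R : realType) (n : nat) (r : R) : 0 < r ->
  (leb R n).-integrable setT
    (fun x => (expR 1 * expR (- (r ^- 2 * dot x x)))%:E).
Proof.
move=> r0; apply/integrableP; split.
  by apply/measurable_EFinP; apply: measurable_funM => //; exact: measurable_expR_dot.
under eq_integral do rewrite /= ger0_norm ?mulr_ge0 ?expR_ge0//.
by rewrite integral_gauss_scaled// ltry.
Qed.

Lemma integrable_cutoffX (R : realType) (n : nat) (r : R) (k : nat) : 0 < r ->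
  (leb R n).-integrable setT (fun x => (cutoff r x ^+ k.+1)%:E).
Proof.
move=> r0; apply: (le_integrable measurableT _ _ (integrable_gauss_scaled n r0)).
  by apply/measurable_EFinP; apply: measurable_funX; exact: measurable_cutoff.
move=> x _; rewrite !abse_EFin lee_fin !ger0_norm ?mulr_ge0 ?expR_ge0 ?exprn_ge0 ?cutoff_ge0//.
exact: cutoffX_le_gauss.
Qed.

(** The constant [C] is that of the kernel; it is chosen before the power and
    the radius, whose contributions to the bound are explicit. *)
Lemma fraclap_cutoff (R : realType) (n : nat) (s : R) : 0 < s < 1 ->
  exists2 C : R, 0 <= C & forall (k : nat) (r : R), 0 < r ->
    exists2 g : 'rV[R]_n -> R, fraclap s (fun x => cutoff r x ^+ k.+2) g &
      forall x, g x <= k.+2%:R * cutoff r x ^+ k.+1 * (C * r `^ (- (2 * s))).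
Proof.
move=> s01; have [K [C [mK K0 C0 KE Kmin]]] := levy_kernel n s01.
exists C => // k r r0.
have i1 := @integrable_cutoffX R n r k.+1 r0.
have i2 := integrableZl measurableT k.+2%:R (@integrable_cutoffX R n r k r0).
have b0 (x : 'rV[R]_n) : 0 <= k.+2%:R * cutoff r x ^+ k.+1 by rewrite mulr_ge0 ?exprn_ge0 ?cutoff_ge0.
exists (levy_op K (fun x => cutoff r x ^+ k.+2)).
  exact: (fraclap_levy_op mK K0 KE (Kmin _ r0) i1 i2 b0 (@sdiff_cutoff R n r k.+1)).
exact: (levy_op_le mK K0 (Kmin _ r0) i1 b0 (@sdiff_cutoff R n r k.+1)).
Qed.

(** * Smoothness of the test function *)

(** A quadratic remainder forces the derivative. This is applied to the square
    of the positive part, whose kink at 0 no differentiation rule covers. *)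
Lemma is_derive_quadratic (R : realType) (f : R -> R) (v d : R) :
  (forall h, `|f (v + h) - f v - d * h| <= h ^+ 2) -> is_derive v 1 f d.
Proof.
move=> H.
have cv : h^-1 *: ((f \o shift v) (h *: 1) - f v) @[h --> 0^'] --> d.
  apply/cvgrPdist_le => /= e e0; near=> h.
  have h0 : h != 0 by near: h; exact: nbhs_dnbhs_neq.
  have he : `|h| <= e.
    near: h; apply: dnbhs0_le; exact: e0.
  rewrite /GRing.scale /= mulr1 -(ler_pM2l (_ : 0 < `|h|)) ?normr_gt0// -normrM.
  rewrite mulrBr mulrA divff// mul1r distrC.
  apply: (@le_trans _ _ (h ^+ 2)); last first.
    by rewrite -(real_normK (num_real h)) expr2 ler_wpM2l.
  by have := H h; rewrite [v + h]addrC [h * d]mulrC.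
split; last exact: cvg_lim.
by apply/cvg_ex; exists d.
Unshelve. all: by end_near. Qed.

Lemma is_derive_exprn (R : realType) (j : nat) (v : R) :
  is_derive v 1 (fun v : R => v ^+ j) (j%:R * v ^+ j.-1).
Proof.
case: j => [|j].
  by rewrite mul0r; apply: is_derive_cst.
elim: j => [|j IH].
  rewrite /= expr0 mulr1; apply: (is_derive_eq (is_derive_id v 1)) => //.
have := is_deriveM IH (is_derive_id v (1 : R)) => /is_derive_eq.
rewrite (_ : _ * _ = (fun v : R => v ^+ j.+2)).
  by apply; rewrite /GRing.scale /= exprS -[j.+2%:R]natr1; ring.
by apply/funext => u; rewrite [RHS]exprSr.
Qed.

Definition pospart (R : realType) (v : R) : R := Num.max 0 v.

Lemma is_derive_pospart2 (R : realType) (v : R) :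
  is_derive v 1 (fun v => pospart v ^+ 2) (2 * pospart v).
Proof.
apply: is_derive_quadratic => h; rewrite /pospart.
rewrite ler_norml; apply/andP.
by case: (leP 0 v); case: (leP 0 (v + h)); split; nra.
Qed.

(** [pospart v ^+ j.+2] is the product of the smooth [v ^+ j] with
    [pospart v ^+ 2], which is differentiable at 0 as well. *)
Lemma is_derive_pospartX (R : realType) (j : nat) (v : R) :
  is_derive v 1 (fun v => pospart v ^+ j.+2) (j.+2%:R * pospart v ^+ j.+1).
Proof.
have dp := is_derive_pospart2 v.
have pu (u : R) i : u ^+ i * pospart u ^+ 2 = pospart u ^+ i.+2.
  rewrite /pospart; have [u0|u0] := leP 0 u; first by rewrite -exprD addn2.
  by rewrite !expr0n /= mulr0.
have {}dp : is_derive v 1 (fun v => v ^+ j * pospart v ^+ 2)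
    (j%:R * v ^+ j.-1 * pospart v ^+ 2 + v ^+ j * (2 * pospart v)).
  have dj : is_derive v 1 (fun v : R => v ^+ j) (j%:R * v ^+ j.-1).
    exact: is_derive_exprn.
  apply: (is_derive_eq (is_deriveM dj dp)); rewrite /GRing.scale /=; ring.
rewrite (_ : (fun v => _) = (fun v => v ^+ j * pospart v ^+ 2)).
  rewrite (_ : _ * _ = (j%:R * v ^+ j.-1 * pospart v ^+ 2 + v ^+ j * (2 * pospart v)))//.
  have pu1 : v ^+ j * pospart v = pospart v ^+ j.+1.
    rewrite /pospart; have [v0|v0] := leP 0 v; first by rewrite -exprSr.
    by rewrite mulr0 expr0n.
  rewrite [v ^+ j * (_ * _)]mulrCA pu1 -[j%:R * _ * _]mulrA pu.
  case: j {dp pu1} => [|j] /=; first by rewrite mul0r add0r.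
  by rewrite -mulrDl -natrD addn2.
by apply/funext => u; rewrite pu.
Qed.

(** Directional derivatives are one-dimensional derivatives along the line
    through [x]; this gives access to the chain rule on R. *)
Lemma is_derive_line (R : realType) (V : normedModType R) (f : V -> R) (x v : V) (d : R) :
  is_derive (0 : R) 1 (fun h : R => f (h *: v + x)) d -> is_derive x v f d.
Proof.
move=> [df <-]; set d' := derive _ _ _.
have C : h^-1 *: ((f \o shift x) (h *: v) - f x) @[h --> 0^'] --> d'.
  have E : (fun h : R => h^-1 *: (((fun h : R => f (h *: v + x)) \o shift 0) (h *: 1) -
      (fun h : R => f (h *: v + x)) 0)) =
      (fun h => h^-1 *: ((f \o shift x) (h *: v) - f x)).
    apply/funext => h; rewrite /= addr0 scale0r add0r.
    by congr (_ *: (f (_ *: _ + _) - _)); exact: mulr1.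
  by rewrite -E; exact: df.
apply: DeriveDef; last exact: cvg_lim.
by apply/cvg_ex; exists d'.
Qed.

Lemma is_derive_coord (R : realType) (n : nat) (x : 'rV[R]_n) (i j : 'I_n) :
  is_derive x (delta_mx 0 i) (fun x : 'rV[R]_n => x ord0 j) (i == j)%:R.
Proof.
apply: is_derive_line.
rewrite (_ : (fun h => _) = (fun h : R => h * (i == j)%:R + x ord0 j)).
  by apply: trigger_derive; rewrite /GRing.scale /=; ring.
by apply/funext => h; rewrite !mxE eqxx /= eq_sym.
Qed.

(** Along a line the cutoff is the positive part of a quadratic polynomial. *)
Lemma is_derive_cutoffX (R : realType) (n : nat) (r : R) (k : nat)
    (x : 'rV[R]_n) (i : 'I_n) :
  is_derive x (delta_mx 0 i) (fun x => cutoff r x ^+ k.+2)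
    (k.+2%:R * cutoff r x ^+ k.+1 * (- (2 / r ^+ 2) * x ord0 i)).
Proof.
apply: is_derive_line.
pose q (h : R) := 1 - (dot x x + 2 * h * x ord0 i + h ^+ 2) / r ^+ 2.
have E h : 1 - dot (h *: delta_mx 0 i + x) (h *: delta_mx 0 i + x) / r ^+ 2 = q h.
  have dd (y : 'rV[R]_n) : dot (delta_mx 0 i) y = y ord0 i.
    rewrite /dot (bigD1 i)//= big1 ?addr0 => [|j ji].
      by rewrite !mxE !eqxx mul1r.
    by rewrite !mxE (negbTE ji) andbF mul0r.
  rewrite /q; congr (1 - _ / _).
  rewrite !dotDl !dotZl dd [dot x (_ + _)]dotC dotDl dotZl dd !mxE !eqxx/=; ring.
rewrite (_ : (fun h => _) = (fun v => pospart v ^+ k.+2) \o q); last first.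
  by apply/funext => h; rewrite /= -E.
have dq : is_derive (0 : R) 1 q (- (2 / r ^+ 2) * x ord0 i).
  by rewrite /q; apply: trigger_derive; rewrite /GRing.scale /=; ring.
have q0 : cutoff r x = pospart (q 0) by rewrite /q /cutoff mulr0 mul0r expr0n /= !addr0.
rewrite q0.
exact: is_derive1_comp (is_derive_pospartX k (q 0)) dq.
Qed.

Lemma continuous_dot (R : realType) (n : nat) : continuous (fun x : 'rV[R]_n => dot x x).
Proof.
apply: (@continuous_big R^o _ +%R 0 xpredT); first exact: add_continuous.
move=> i _ x; apply: (@continuousM _ _ (fun x : 'rV[R]_n => x ord0 i)
  (fun x : 'rV[R]_n => x ord0 i)); exact: coord_continuous.
Qed.

Lemma continuous_cutoff (R : realType) (n : nat) (r : R) : continuous (@cutoff R n r).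
Proof.
have c1 : continuous (fun v : R => 1 - v / r ^+ 2).
  move=> v; apply: cvgB; first exact: cvg_cst.
  by apply: cvgM; [exact: cvg_id|exact: cvg_cst].
have c2 : continuous (fun v : R => Num.max 0 (1 - v / r ^+ 2)).
  have E v : Num.max 0 (1 - v / r ^+ 2) =
      2^-1 * ((1 - v / r ^+ 2) + `|1 - v / r ^+ 2|).
    by rewrite maxr_absE add0r sub0r normrN mulrC.
  under eq_fun do rewrite E.
  move=> v; apply: cvgM; first exact: cvg_cst.
  by apply: cvgD; [exact: c1|apply: cvg_norm; exact: c1].
move=> x; exact: (@continuous_comp _ _ _ (fun x : 'rV[R]_n => dot x x) _ x
  (@continuous_dot R n x) (c2 _)).
Qed.

Section test_function.
Variables (R : realType) (n : nat) (r T : R) (k : nat).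

(** The exponent is at least 3, so that two derivatives in space leave a
    positive, hence continuous, power of the cutoff. *)
Definition test_fun (z : R * 'rV[R]_n) : R :=
  (1 - z.1 / T) ^+ k.+3 * cutoff r z.2 ^+ k.+3.

Let eta (j : nat) (t : R) : R := (1 - t / T) ^+ j.

Let cont_x (f : 'rV[R]_n -> R) : continuous f ->
  continuous (fun z : R * 'rV[R]_n => f z.2).
Proof. by move=> cf z; apply: continuous_comp; [exact: cvg_snd|exact: cf]. Qed.

Let cont_t (f : R -> R) : continuous f ->
  continuous (fun z : R * 'rV[R]_n => f z.1).
Proof. by move=> cf z; apply: continuous_comp; [exact: cvg_fst|exact: cf]. Qed.

Let cont_cutoffX j : continuous (fun x : 'rV[R]_n => cutoff r x ^+ j).
Proof.
move=> x; exact: (@continuous_comp _ _ _ (@cutoff R n r) (fun v => v ^+ j) x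
  (@continuous_cutoff R n r x) (@exprn_continuous R j _)).
Qed.

Let cont_coord (i : 'I_n) : continuous (fun x : 'rV[R]_n => x ord0 i).
Proof. exact: coord_continuous. Qed.

Let cont_eta j : continuous (eta j).
Proof.
have c1 : continuous (fun t : R => 1 - t / T).
  by move=> t; apply: cvgB; [exact: cvg_cst|apply: cvgM; [exact: cvg_id|exact: cvg_cst]].
move=> t; exact: (@continuous_comp _ _ _ (fun t : R => 1 - t / T) (fun v : R => v ^+ j) t
  (c1 t) (@exprn_continuous R j _)).
Qed.

Let cM (f g : R * 'rV[R]_n -> R) :
  continuous f -> continuous g -> continuous (fun z => f z * g z).
Proof. by move=> cf cg z; apply: cvgM; [exact: cf|exact: cg]. Qed.

Let cD (f g : R * 'rV[R]_n -> R) :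
  continuous f -> continuous g -> continuous (fun z => f z + g z).
Proof. by move=> cf cg z; apply: cvgD; [exact: cf|exact: cg]. Qed.

Let cc (c : R) : continuous (fun _ : R * 'rV[R]_n => c).
Proof. exact: cst_continuous. Qed.

Let is_derive_eta j (t : R) : is_derive t 1 (eta j.+1) (- (j.+1%:R / T) * eta j t).
Proof.
have d : is_derive t 1 (fun t : R => 1 - t / T) (- T^-1).
  by apply: trigger_derive; rewrite /GRing.scale /=; ring.
apply: (is_derive_eq (@is_derive1_comp R (fun v => v ^+ j.+1) (fun t => 1 - t / T) t _ _
  (is_derive_exprn j.+1 (1 - t / T)) d)).
by rewrite /eta /=; ring.
Qed.

Lemma is_derive_test_fun_t (t : R) (x : 'rV[R]_n) : is_derive t 1 (fun t => test_fun (t, x))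
  (- (k.+3%:R / T) * (1 - t / T) ^+ k.+2 * cutoff r x ^+ k.+3).
Proof.
have d := is_derive_eta k.+2 t.
have := is_deriveZ (cutoff r x ^+ k.+3) d => /is_derive_eq.
rewrite /GRing.scale /=.
rewrite (_ : _ \*: _ = (fun t => test_fun (t, x))).
  by apply; rewrite /eta mulrC.
by apply/funext => u; rewrite /test_fun /eta /= /GRing.scale /= mulrC.
Qed.

Let a := - (2 / r ^+ 2).

Lemma dx_test_fun i : dx i test_fun = fun z =>
  eta k.+3 z.1 * (k.+3%:R * cutoff r z.2 ^+ k.+2 * (a * z.2 ord0 i)).
Proof.
apply/funext => z; rewrite /dx /test_fun /=.
have d := is_deriveZ (eta k.+3 z.1) (is_derive_cutoffX r k.+1 z.2 i).
by rewrite [LHS](@derive_val _ _ _ _ _ _ _ d).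
Qed.

Let derivable_test_fun i z : derivable_x i test_fun z.
Proof.
have d := is_deriveZ (eta k.+3 z.1) (is_derive_cutoffX r k.+1 z.2 i).
exact: (@ex_derive _ _ _ _ _ _ _ d).
Qed.

Let is_derive2 (i j : 'I_n) (z : R * 'rV[R]_n) :
  is_derive z.2 (delta_mx 0 i) (fun x => dx j test_fun (z.1, x))
    (eta k.+3 z.1 * k.+3%:R * a *
      (cutoff r z.2 ^+ k.+2 * (i == j)%:R +
       z.2 ord0 j * (k.+2%:R * cutoff r z.2 ^+ k.+1 * (a * z.2 ord0 i)))).
Proof.
rewrite dx_test_fun /=.
have d := is_deriveZ (eta k.+3 z.1 * k.+3%:R * a)
  (is_deriveM (is_derive_cutoffX r k z.2 i) (is_derive_coord z.2 i j)).
have {}d := is_derive_eq d erefl.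
rewrite (_ : (fun x => _) = (eta k.+3 z.1 * k.+3%:R * a) \*:
   ((fun x : 'rV[R]_n => cutoff r x ^+ k.+2) * (fun x => x ord0 j))).
  exact: d.
apply/funext => x; rewrite /= fctM /= /GRing.scale /=; ring.
Qed.

Lemma C12_test_fun : C12 T test_fun.
Proof.
have ct j := cont_t (@cont_eta j).
have cx j := cont_x (@cont_cutoffX j).
have ci i := cont_x (@cont_coord i).
split.
- apply: continuous_subspaceT; exact: (cM (ct k.+3) (cx k.+3)).
- exists (fun z => - (k.+3%:R / T) * eta k.+2 z.1 * cutoff r z.2 ^+ k.+3).
    apply: continuous_subspaceT; exact: (cM (cM (@cc _) (ct k.+2)) (cx k.+3)).
  move=> t x _; have d := is_derive_test_fun_t t x.
  split; first exact: (@ex_derive _ _ _ _ _ _ _ d).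
  by rewrite /dt /= derive1E; exact: (@derive_val _ _ _ _ _ _ _ d).
- move=> i; split; last by move=> z _; exact: derivable_test_fun.
  rewrite dx_test_fun; apply: continuous_subspaceT.
  exact: (cM (ct k.+3) (cM (cM (@cc _) (cx k.+2)) (cM (@cc a) (ci i)))).
- move=> i j; split; last first.
    by move=> z _; exact: (@ex_derive _ _ _ _ _ _ _ (is_derive2 i j z)).
  rewrite (_ : dx i _ = fun z => eta k.+3 z.1 * k.+3%:R * a *
      (cutoff r z.2 ^+ k.+2 * (i == j)%:R +
       z.2 ord0 j * (k.+2%:R * cutoff r z.2 ^+ k.+1 * (a * z.2 ord0 i)))); last first.
    by apply/funext => z; exact: (@derive_val _ _ _ _ _ _ _ (is_derive2 i j z)).
  apply: continuous_subspaceT.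
  exact: (cM (cM (cM (ct k.+3) (@cc _)) (@cc a)) (cD (cM (cx k.+2) (@cc _))
    (cM (ci j) (cM (cM (@cc _) (cx k.+1)) (cM (@cc a) (ci i)))))).
Qed.

End test_function.

(** * Cylinders and elementary inequalities *)

Lemma measurable_cyl (R : realType) (n : nat) (I : interval R) :
  measurable (cyl n I : set (measurableTypeR R * 'rV[R]_n)).
Proof. by apply: measurableX => //; exact: measurable_itv. Qed.

Lemma integral_cyl (R : realType) (n : nat) (I : interval R)
    (f : measurableTypeR R * 'rV[R]_n -> \bar R) :
  measurable_fun (cyl n I) f -> (forall z, cyl n I z -> (0 <= f z)%E) ->
  (\int[lebtx R n]_(z in cyl n I) f z =
   \int[lebesgue_measure]_(t in [set` I]) \int[leb R n]_x f (t, x))%E.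
Proof.
move=> mf f0; rewrite integral_mkcond.
have mF : measurable_fun setT (f \_ (cyl n I)).
  by apply/(measurable_restrictT _ _).1 => //; exact: measurable_cyl.
have F0 z : (0 <= (f \_ (cyl n I)) z)%E by exact: erestrict_ge0.
rewrite /lebtx fubini_tonelli1; [|exact: mF|exact: F0].
rewrite /fubini_F [RHS]integral_mkcond.
apply: eq_integral => t _; rewrite [in RHS]patchE.
case: ifPn => tI.
  apply: eq_integral => x _; rewrite patchE mem_set//=; split => //.
  by move: tI; rewrite inE.
apply: integral0_eq => x _; rewrite patchE memNset//= => -[/= tI' _].
by move/negP : tI; apply; rewrite inE.
Qed.

Lemma integral_cyl_space (R : realType) (n : nat) (T : R) (H : 'rV[R]_n -> R) :
  0 < T -> measurable_fun setT H -> (forall x, 0 <= H x) ->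
  (\int[lebtx R n]_(z in cyl n `]0%R, T[) (H z.2)%:E =
   T%:E * \int[leb R n]_x (H x)%:E)%E.
Proof.
move=> T0 mH H0; rewrite integral_cyl//=; last 2 first.
- apply: measurable_funTS; apply/measurable_EFinP.
  exact: (measurableT_comp mH measurable_snd).
- by move=> z _; rewrite lee_fin.
rewrite integral_cst//= lebesgue_measure_itv/= lte_fin T0 oppr0 adde0.
by rewrite muleC.
Qed.

Lemma measurable_box (R : realType) (n : nat) (r : R) :
  measurable [set x : 'rV[R]_n | forall i, x ord0 i \in `[- r, r]].
Proof.
rewrite (_ : mkset _ = \bigcap_(i in [set: 'I_n]) ((@rV_coord R n i) @^-1` `[- r, r])).
  apply: fin_bigcap_measurable => // i _.
  rewrite -[X in measurable X]setTI; apply: measurable_rV_coord => //.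
by apply/seteqP; split => x /= H i; [move=> _; exact: H|exact: (H i I)].
Qed.

Lemma compact_box (R : realType) (n : nat) (r : R) :
  compact [set x : 'rV[R]_n | forall i, x ord0 i \in `[- r, r]].
Proof.
have := @rV_compact R n (fun _ => `[- r, r]%classic) (fun _ => @segment_compact R (- r) r).
by [].
Qed.

Lemma coord_le_enorm (R : realType) (n : nat) (x : 'rV[R]_n) (i : 'I_n) :
  `|x ord0 i| <= enorm x.
Proof.
rewrite -sqrtr_sqr; apply: ler_wsqrtr; rewrite /dot (bigD1 i)//= expr2 lerDl.
by apply: sumr_ge0 => j _; rewrite -expr2 sqr_ge0.
Qed.

Lemma cutoff_box (R : realType) (n : nat) (r : R) (x : 'rV[R]_n) : 0 < r ->
  ~ (forall i, x ord0 i \in `[- r, r]) -> cutoff r x = 0.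
Proof.
move=> r0 nb; apply: cutoff_outside => //; rewrite ltNge; apply/negP => xr.
apply: nb => i; rewrite in_itv/= -ler_norml.
exact: le_trans (coord_le_enorm x i) xr.
Qed.

Lemma fraclapZ (R : realType) (n : nat) (s c : R) (f g : 'rV[R]_n -> R) :
  fraclap s f g -> fraclap s (fun x => c * f x) (fun x => c * g x).
Proof.
move=> [intf intg FE]; split.
- exact: (integrableZl measurableT c intf).
- exact: (integrableZl measurableT c intg).
have trig (h : 'rV[R]_n -> R) (tr : R -> R) xi : (leb R n).-integrable setT (EFin \o h) ->
    continuous tr -> (forall x, `|tr x| <= 1) ->
    \int[leb R n]_x (c * h x * tr (dot x xi)) = c * \int[leb R n]_x (h x * tr (dot x xi)).
  move=> ih ctr tr1; rewrite -RintegralZl//.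
    by apply: eq_Rintegral => x _; rewrite mulrA.
  have /integrableP[/measurable_EFinP mh _] := ih.
  apply: (le_integrable measurableT _ _ ih).
    apply/measurable_EFinP; apply: measurable_funM => //.
    by apply: (measurableT_comp (continuous_measurable_fun ctr)); exact: measurable_dot.
  by move=> x _; rewrite !abse_EFin lee_fin normrM ler_piMr.
have FZ h xi : (leb R n).-integrable setT (EFin \o h) ->
    fourier (fun x => c * h x) xi = (c%:C)%C * fourier h xi.
  move=> ih; rewrite /fourier !trig//; [|exact: continuous_sin|exact: sin_max
    |exact: continuous_cos|exact: cos_max].
  by apply/eqP; rewrite eq_complex /= !mul0r subr0 addr0 mulrN !eqxx.
by move=> xi; rewrite !FZ// FE mulrCA.
Qed.

(** Young's inequality for [d a] and [M / d], with [d] such that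
    [d^p = 1/4]; the weight 1/4 is chosen because the inequality is applied
    twice and half of the left-hand side has to remain. *)
Lemma young_quarter (R : realType) (p q : R) : 1 < p -> q = p / (p - 1) ->
  exists2 K : R, 0 <= K & forall a M : R, 0 <= a -> 0 <= M ->
    a * M <= 4^-1 * a `^ p + K * M `^ q.
Proof.
move=> p1 qE.
have p0 : 0 < p by exact: lt_trans p1.
have pm : 0 < p - 1 by rewrite subr_gt0.
have q0 : 0 < q by rewrite qE divr_gt0.
have pq : p^-1 + q^-1 = 1.
  by rewrite qE; field; rewrite !gt_eqF.
pose d := 4^-1 `^ p^-1 : R.
have d0 : 0 < d by rewrite powR_gt0.
have dp : d `^ p = 4^-1.
  by rewrite /d -powRrM mulVf ?gt_eqF// powRr1.
exists (d^-1 `^ q / q); first by rewrite divr_ge0 ?powR_ge0// ltW.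
move=> a M a0 M0.
have -> : a * M = (d * a) * (d^-1 * M) by rewrite mulrACA divff ?gt_eqF// mul1r.
have di : 0 <= d^-1 by rewrite invr_ge0 ltW.
have := conjugate_powR (mulr_ge0 (ltW d0) a0) (mulr_ge0 di M0) p0 q0 pq.
move/le_trans; apply.
rewrite (powRM _ (ltW d0) a0) (powRM _ di M0) dp [_ / q]mulrAC lerD//.
rewrite ler_pdivrMr// ler_peMr ?mulr_ge0 ?powR_ge0// ltW//.
Qed.

(** Young's inequality with [M / th] in place of [M], multiplied by
    [th^(l+2)]: the surplus factor [th^(l+2-q)] is at most 1. This
    is why the power in the test function must be at least [q]. *)
Lemma young_weight (R : realType) (p q K : R) (l : nat) (a M th : R) :
  (forall a M : R, 0 <= a -> 0 <= M -> a * M <= 4^-1 * a `^ p + K * M `^ q) ->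
  0 <= K -> 0 <= a -> 0 <= M -> 0 <= th <= 1 -> q <= l.+2%:R ->
  a * M * th ^+ l.+1 <= 4^-1 * a `^ p * th ^+ l.+2 + K * M `^ q.
Proof.
move=> Y K0 a0 M0 /andP[]; rewrite le_eqVlt => /predU1P[<- _ _|th0 th1 ql].
  by rewrite !expr0n /= !mulr0 add0r mulr_ge0 ?powR_ge0.
have thi : 0 <= th^-1 by rewrite invr_ge0 ltW.
have -> : a * M * th ^+ l.+1 = th ^+ l.+2 * (a * (M * th^-1)).
  by rewrite [th ^+ l.+2]exprS; field; rewrite gt_eqF.
apply: (le_trans (ler_wpM2l _ (Y _ _ a0 (mulr_ge0 M0 thi)))).
  by rewrite exprn_ge0// ltW.
rewrite mulrDr mulrC lerD2l mulrCA ler_wpM2l//.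
rewrite (powRM _ M0 thi) mulrCA ler_piMr ?powR_ge0//.
rewrite -(powR_inv1 (ltW th0)) -powRrM mulN1r -(powR_mulrn _ (ltW th0)).
rewrite -powRD; last by rewrite (gt_eqF th0) implybT.
rewrite -[leRHS](powRr0 th); apply: ger_powR; rewrite ?th0//.
by rewrite subr_ge0.
Qed.

Lemma cutoff_half (R : realType) (n : nat) (r : R) (x : 'rV[R]_n) : 0 < r ->
  enorm x <= r / 2 -> 2^-1 <= cutoff r x.
Proof.
move=> r0 xr; rewrite le_max; apply/orP; right.
have : dot x x / r ^+ 2 <= 2^-1; last by lra.
rewrite -enorm_sqr ler_pdivrMr ?exprn_gt0//.
have := enorm_ge0 x; nra.
Qed.

(** On [T/4, T] the power [t^m] is comparable to [T^m] for either sign of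
    [m]; the constant is not sharp when [m] is negative. *)
Lemma powR_quarter_le (R : realType) (m T t : R) : 0 < T ->
  T / 4 <= t <= T -> 4 `^ (- `|m|) * T `^ m <= t `^ m.
Proof.
move=> T0 /andP[Tt tT].
have t0 : 0 < t by apply: lt_le_trans Tt; rewrite divr_gt0.
have [m0|m0] := leP 0 m.
  rewrite (ger0_norm m0) -mulN1r powRrM powR_inv1//.
  rewrite -powRM ?(ltW T0)//; apply: ge0_ler_powR => //; rewrite ?nnegrE ?(ltW t0)//.
    by rewrite mulr_ge0// ltW.
  by rewrite mulrC.
apply: (@le_trans _ _ (T `^ m)).
  rewrite ler_piMl ?powR_ge0// -[leRHS](powRr0 4); apply: ler_powR.
    by rewrite ler1n.
  by rewrite oppr_le0.
rewrite -(opprK m) !(powRN _ (- m)) lef_pV2 ?posrE ?powR_gt0//.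
apply: ge0_ler_powR => //; rewrite ?nnegrE ?(ltW t0) ?(ltW T0)// oppr_ge0.
exact: ltW.
Qed.

(** A contradiction arises at any large [r] with [C / c < r^(a - b)]. *)
Lemma powR_dominates (R : realType) (a b c C R0 : R) : b < a -> 0 < c ->
  (forall r : R, R0 <= r -> 1 <= r -> c * r `^ a <= C * r `^ b) -> False.
Proof.
move=> ba c0 H.
pose D := Num.max 1 (C / c) + 1.
have D1 : 1 <= D by rewrite /D -[leLHS]add0r lerD// le_max ler01.
have ab0 : 0 < a - b by rewrite subr_gt0.
pose r := Num.max R0 (D `^ (a - b)^-1).
have r1 : 1 <= r.
  rewrite le_max; apply/orP; right; rewrite -[leLHS](powRr0 D); apply: ler_powR => //.
  by rewrite invr_ge0 ltW.
have r0 : 0 < r by exact: lt_le_trans r1.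
have Rr : R0 <= r by rewrite le_max lexx.
have := H r Rr r1.
have -> : r `^ a = r `^ (a - b) * r `^ b.
  by rewrite -powRD ?subrK// (gt_eqF r0) implybT.
rewrite mulrA ler_pM2r ?powR_gt0// => HC.
have Dr : D <= r `^ (a - b).
  rewrite -[leLHS](powRr1 (le_trans ler01 D1)) -(mulVf (lt0r_neq0 ab0)) powRrM.
  apply: ge0_ler_powR; rewrite ?nnegrE ?powR_ge0 ?(ltW ab0) ?(ltW r0)//.
  by rewrite le_max lexx orbT.
have : C / c < D.
  rewrite /D; apply: (@le_lt_trans _ _ (Num.max 1 (C / c))); first by rewrite le_max lexx orbT.
  by rewrite ltrDl.
rewrite ltr_pdivrMr// => CD.
have := lt_le_trans CD (le_trans _ HC).
rewrite mulrC ler_pM2l// => /(_ Dr).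
by rewrite ltxx.
Qed.

(** * Admissibility of the test function *)

Section test_function_estimates.
Variables (R : realType) (n : nat) (r T : R) (k : nat).
Hypotheses (r0 : 0 < r) (T0 : 0 < T).
Notation phi := (@test_fun R n r T k).

Let eta01 t : 0 <= t <= T -> 0 <= 1 - t / T <= 1.
Proof.
move=> /andP[t0 tT]; rewrite subr_ge0 ler_pdivrMr// mul1r tT/=.
by rewrite gerBl divr_ge0// ltW.
Qed.

Lemma test_fun_ge0 t x : 0 <= t <= T -> 0 <= phi (t, x).
Proof.
move=> /eta01/andP[e0 e1].
by rewrite mulr_ge0// exprn_ge0// cutoff_ge0.
Qed.

Lemma test_fun_le1 t x : 0 <= t <= T -> phi (t, x) <= 1.
Proof.
move=> /eta01/andP[e0 e1].
by rewrite mulr_ile1 ?exprn_ge0 ?exprn_ile1 ?cutoff_ge0 ?cutoff_le1.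
Qed.

Lemma measurable_test_fun :
  measurable_fun setT (phi : measurableTypeR R * 'rV[R]_n -> R).
Proof.
apply: measurable_funM; apply: measurable_funX.
  by apply: measurable_funB => //; apply: measurable_funM => //; exact: measurable_fst.
exact: (measurableT_comp (@measurable_cutoff R n r) measurable_snd).
Qed.

Lemma dt_test_fun z : dt phi z =
  - (k.+3%:R / T) * (1 - z.1 / T) ^+ k.+2 * cutoff r z.2 ^+ k.+3.
Proof.
rewrite /dt derive1E; have d := is_derive_test_fun_t r T k z.1 z.2.
exact: (@derive_val _ _ _ _ _ _ _ d).
Qed.

(** The time factor is constant in space, so the fractional Laplacian of a time
    slice is the time factor times that of the power of the cutoff. *)
Lemma admissible_test_fun (s : R) (g : 'rV[R]_n -> R) :
  fraclap s (fun x => cutoff r x ^+ k.+3) g ->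
  admissible s T phi (fun z => (1 - z.1 / T) ^+ k.+3 * g z.2).
Proof.
move=> fg; split.
- exact: C12_test_fun.
- exact: test_fun_ge0.
- exists [set x | forall i, x ord0 i \in `[- r, r]]; first exact: compact_box.
  by move=> t x _ nb; rewrite /test_fun /= (cutoff_box r0 nb) expr0n /= mulr0.
- by move=> x; rewrite /test_fun /= divff ?gt_eqF// subrr expr0n /= mul0r.
- split => [t tT|]; first exact: (fraclapZ ((1 - t / T) ^+ k.+3) fg).
  have [_ ig _] := fg; have /integrableP[/measurable_EFinP mg ltg] := ig.
  apply/integrableP; split.
    apply: measurable_funTS; apply/measurable_EFinP; apply: measurable_funM.
      apply: measurable_funX; apply: measurable_funB => //.
      by apply: measurable_funM => //; exact: measurable_fst.
    exact: (measurableT_comp mg measurable_snd).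
  apply: (@le_lt_trans _ _ (\int[lebtx R n]_(z in cyl n `]0%R, T[) (`|g z.2|)%:E)%E).
    apply: ge0_le_integral => //.
    + exact: measurable_cyl.
    + apply: measurableT_comp => //; apply: measurable_funTS; apply/measurable_EFinP; apply: measurable_funM.
        apply: measurable_funX; apply: measurable_funB => //.
        by apply: measurable_funM => //; exact: measurable_fst.
      exact: (measurableT_comp mg measurable_snd).
    + apply: measurable_funTS; apply/measurable_EFinP; apply: measurableT_comp => //.
      exact: (measurableT_comp mg measurable_snd).
    + move=> [t x] [/=]; rewrite in_itv/= => /andP[t0 tT] _.
      have /andP[e0 e1] : 0 <= 1 - t / T <= 1 by apply: eta01; rewrite !ltW.
      rewrite lee_fin normrM ler_piMl// ger0_norm ?exprn_ge0//.
      by rewrite exprn_ile1.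
  rewrite (@integral_cyl_space _ _ T (fun x => `|g x|))//; last exact: measurableT_comp.
  by rewrite lte_mul_pinfty// lee_fin ltW.
Qed.

End test_function_estimates.

(** * Upper bound on the source *)

(** Arithmetic of extended reals: [P] and [N] stand for the integrals of the two
    parts of a function, both of which may be infinite. *)
Lemma oppe_sub_le (R : realType) (P N : \bar R) :
  (0 <= P -> 0 <= N -> - (P - N) <= N)%E.
Proof.
case: P => [P| |]; case: N => [N| |] //=; rewrite ?lee_fin ?leey ?leNye//.
by move=> P0 N0; rewrite ?lee_fin; lra.
Qed.

(** If both parts of [f] have infinite integral, then so does [b]. *)
Lemma integral_oppr_le (R : realType) d (T : measurableType d)
    (mu : {measure set T -> \bar R}) (D : set T) (f b : T -> \bar R) :
  measurable D -> measurable_fun D f -> measurable_fun D b ->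
  (forall x, D x -> `|f x| <= b x)%E ->
  (- (\int[mu]_(x in D) f x) <= \int[mu]_(x in D) b x)%E.
Proof.
move=> mD mf mb fb; rewrite integralE.
have P0 : (0 <= \int[mu]_(x in D) f^\+ x)%E by exact: integral_ge0.
have N0 : (0 <= \int[mu]_(x in D) f^\- x)%E by exact: integral_ge0.
apply: (le_trans (oppe_sub_le P0 N0)).
apply: ge0_le_integral => //; first exact: measurable_funeneg.
move=> x Dx; apply: le_trans (fb x Dx).
rewrite funenegE ge_max abse_ge0 andbT.
by case: (f x) => //= y; rewrite lee_fin -normrN ler_norm.
Qed.

(** The comparison goes through the positive part of [f]; the negative part
    may have infinite integral. *)
Lemma ae_integral_le (R : realType) d (T : measurableType d)
    (mu : {measure set T -> \bar R}) (D : set T) (f b : T -> \bar R) :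
  measurable D -> measurable_fun D f -> measurable_fun D b ->
  (forall x, D x -> 0 <= b x)%E ->
  {ae mu, forall x, D x -> (f x <= b x)%E} ->
  (\int[mu]_(x in D) f x <= \int[mu]_(x in D) b x)%E.
Proof.
move=> mD mf mb b0 fb; rewrite integralE.
apply: (@le_trans _ _ (\int[mu]_(x in D) f^\+ x)%E).
  by apply: geeDl; rewrite oppe_le0 integral_ge0.
apply: ae_ge0_le_integral => //; first exact: measurable_funepos.
apply: filterS fb => x fb Dx.
by rewrite funeposE ge_max fb//= b0.
Qed.

Section a_priori_bound.
Variables (R : realType) (n : nat) (s p q : R) (w u : R * 'rV[R]_n -> R)
  (u0 : 'rV[R]_n -> R).
Hypothesis mw : measurable_fun (cyl n `[0, +oo[) w.
Hypothesis w0 : {ae lebtx R n, forall z, 0 <= z.1 -> 0 <= w z}.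
Hypothesis mu0 : measurable_fun setT u0.
Hypothesis u00 : {ae leb R n, forall x, 0 <= u0 x}.
Hypothesis wsol : weak_solution s p w u0 u.

Variables (K C : R) (k : nat).
Hypotheses (K0 : 0 <= K) (C0 : 0 <= C) (qk : q <= k.+3%:R).
Hypothesis young : forall a M : R, 0 <= a -> 0 <= M ->
  a * M <= 4^-1 * a `^ p + K * M `^ q.

Variables (r T : R) (g0 : 'rV[R]_n -> R).
Hypotheses (r0 : 0 < r) (TE : T = r `^ (2 * s)).
Hypothesis fg0 : fraclap s (fun x => cutoff r x ^+ k.+3) g0.
Hypothesis g0_le : forall x,
  g0 x <= k.+3%:R * cutoff r x ^+ k.+2 * (C * r `^ (- (2 * s))).

Notation phi := (@test_fun R n r T k).
Notation Q := (cyl n `]0%R, T[).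
Let M := k.+3%:R * (1 + C) * r `^ (- (2 * s)).
Let G (x : 'rV[R]_n) := expR 1 * expR (- (r ^- 2 * dot x x)).
Let X : \bar R := (\int[lebtx R n]_(z in Q) (`|u z| `^ p * phi z)%:E)%E.
Let W : \bar R := (\int[lebtx R n]_(z in Q) (Num.max 0 (w z) * phi z)%:E)%E.
Let Bd (z : R * 'rV[R]_n) : R :=
  4^-1 * (`|u z| `^ p * phi z) + K * M `^ q * G z.2.
Let D : R := K * M `^ q * (T * (expR 1 * (r * Num.sqrt pi) ^+ n)).

Let T0 : 0 < T.
Proof. by rewrite TE powR_gt0. Qed.

Let M0 : 0 <= M.
Proof. by rewrite !mulr_ge0 ?powR_ge0// addr_ge0. Qed.

Let G0 x : 0 <= G x.
Proof. by rewrite mulr_ge0 ?expR_ge0. Qed.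

Let mQ : measurable (Q : set (measurableTypeR R * 'rV[R]_n)).
Proof. exact: measurable_cyl. Qed.

Let Qsub : Q `<=` cyl n `[0, +oo[.
Proof.
move=> z [] /=; rewrite in_itv/= => /andP[/ltW t0 _] _.
by split => //=; rewrite in_itv/= t0.
Qed.

Let mcyl0 : measurable (cyl n `[0, +oo[ : set (measurableTypeR R * 'rV[R]_n)).
Proof. exact: measurable_cyl. Qed.

Let mu : measurable_fun Q u.
Proof. by have [[mu _] _ _ _] := wsol; exact: (measurable_funS mcyl0 Qsub mu). Qed.

Let mwQ : measurable_fun Q w.
Proof. exact: (measurable_funS mcyl0 Qsub mw). Qed.

Let mphi : measurable_fun Q phi.
Proof. by apply: measurable_funTS; exact: measurable_test_fun. Qed.

Let mup : measurable_fun Q (fun z => `|u z| `^ p).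
Proof.
apply: (measurableT_comp (measurable_powR p)).
exact: measurableT_comp mu.
Qed.

Let mG : measurable_fun setT G.
Proof. by apply: measurable_funM => //; exact: measurable_expR_dot. Qed.

Let theta01 z : Q z -> 0 <= 1 - z.1 / T <= 1.
Proof.
move=> [] /=; rewrite in_itv/= => /andP[/ltW t0 /ltW tT] _.
by rewrite subr_ge0 ler_pdivrMr// mul1r tT/= gerBl divr_ge0// ltW.
Qed.

Let phi0 z : Q z -> 0 <= phi z.
Proof.
case: z => t x [] /=; rewrite in_itv/= => /andP[/ltW t0 /ltW tT] _.
by apply: test_fun_ge0 => //; rewrite t0.
Qed.

Let phi1 z : Q z -> phi z <= 1.
Proof.
case: z => t x [] /=; rewrite in_itv/= => /andP[/ltW t0 /ltW tT] _.
by apply: test_fun_le1 => //; rewrite t0.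
Qed.

Let mX : measurable_fun Q (fun z => (`|u z| `^ p * phi z)%:E).
Proof. by apply/measurable_EFinP; exact: measurable_funM. Qed.

Let mW : measurable_fun Q (fun z => (Num.max 0 (w z) * phi z)%:E).
Proof. by apply/measurable_EFinP; apply: measurable_funM => //; exact: measurable_maxr. Qed.

Let mBd : measurable_fun Q (EFin \o Bd).
Proof.
apply/measurable_EFinP; apply: measurable_funD.
  by apply: measurable_funM => //; exact: measurable_funM.
apply: measurable_funM => //; apply: measurable_funTS.
exact: (measurableT_comp mG measurable_snd).
Qed.

Let X_ge0 : (0 <= X)%E.
Proof. by apply: integral_ge0 => z Qz; rewrite lee_fin mulr_ge0 ?powR_ge0 ?phi0. Qed.

Let W_ge0 : (0 <= W)%E.
Proof.
by apply: integral_ge0 => z Qz; rewrite lee_fin mulr_ge0 ?phi0// le_max lexx.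
Qed.

Let X_lty : (X < +oo)%E.
Proof.
have [[mu' Lp] _ _ _] := wsol.
pose B := [set x : 'rV[R]_n | forall i, x ord0 i \in `[- r, r]].
(* The local integrability of [u] is a statement about compact sets, and the
   sup-norm box is a convenient one containing the support of the cutoff. *)
pose KK : set (R * 'rV[R]_n) := `[0, T]%classic `*` B.
have mKK : measurable (KK : set (measurableTypeR R * 'rV[R]_n)).
  by apply: measurableX; [exact: measurable_itv|exact: measurable_box].
have Ksub : KK `<=` cyl n `[0, +oo[.
  move=> z [] /=; rewrite in_itv/= => /andP[t0 _] _.
  by split => //=; rewrite in_itv/= t0.
have Kc : compact KK by apply: compact_setX; [exact: segment_compact|exact: compact_box].
apply: le_lt_trans (Lp KK Ksub Kc).
rewrite /X [leLHS]integral_mkcond [leRHS]integral_mkcond.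
have mupK : measurable_fun KK (fun z => (`|u z| `^ p)%:E).
  apply/measurable_EFinP; apply: (measurableT_comp (measurable_powR p)).
  by apply: measurableT_comp => //; exact: (measurable_funS mcyl0 Ksub mu').
apply: ge0_le_integral => //.
- by move=> z _; apply: erestrict_ge0 => {}z Qz; rewrite lee_fin mulr_ge0 ?powR_ge0 ?phi0.
- by apply/(measurable_restrictT _ _).1.
- by apply/(measurable_restrictT _ _).1.
- move=> z _; rewrite !patchE; case: ifPn => [|_]; last first.
    by case: ifPn => // _; rewrite lee_fin powR_ge0.
  rewrite inE => Qz; case: ifPn => [_|].
    by rewrite lee_fin ler_piMr ?powR_ge0 ?phi1.
  rewrite notin_setE => nK; rewrite lee_fin /test_fun.
  rewrite (@cutoff_box _ _ r z.2)// ?expr0n /= ?mulr0// => Bz.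
  apply: nK; split => //; case: Qz => /=; rewrite !in_itv/= => /andP[t0 tT] _.
  by rewrite !ltW.
Qed.

Let integral_Bd :
  (\int[lebtx R n]_(z in Q) (Bd z)%:E = 4^-1%:E * X + D%:E)%E.
Proof.
have KM0 : 0 <= K * M `^ q by rewrite mulr_ge0 ?powR_ge0.
pose f1 z := (4^-1%:E * (`|u z| `^ p * phi z)%:E)%E.
pose f2 (z : R * 'rV[R]_n) := ((K * M `^ q)%:E * (G z.2)%:E)%E.
have f10 z : Q z -> (0 <= f1 z)%E.
  move=> Qz; rewrite /f1 -EFinM lee_fin mulr_ge0//.
  by rewrite mulr_ge0 ?powR_ge0 ?phi0.
have f20 z : Q z -> (0 <= f2 z)%E by move=> _; rewrite /f2 -EFinM lee_fin mulr_ge0.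
have mG2 : measurable_fun Q (fun z => (G z.2)%:E).
  apply: measurable_funTS; apply/measurable_EFinP.
  exact: (measurableT_comp mG measurable_snd).
have mf1 : measurable_fun Q f1 by exact: measurable_funeM.
have mf2 : measurable_fun Q f2 by exact: measurable_funeM.
transitivity (\int[lebtx R n]_(z in Q) (f1 z + f2 z))%E.
  by apply: eq_integral => z _; rewrite /f1 /f2 -!EFinM -EFinD.
rewrite ge0_integralD//; congr (_ + _)%E.
  rewrite /f1 ge0_integralZl//=.
  by move=> z Qz; rewrite lee_fin mulr_ge0 ?powR_ge0 ?phi0.
rewrite /f2 ge0_integralZl//=; last by move=> z _; rewrite lee_fin.
rewrite (integral_cyl_space T0 mG G0) integral_gauss_scaled//.
Qed.

Let cutoff01 (x : 'rV[R]_n) : 0 <= cutoff r x <= 1.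
Proof. by rewrite cutoff_ge0 cutoff_le1. Qed.

Let Bd_ge0 z : Q z -> 0 <= Bd z.
Proof.
move=> Qz; apply: addr_ge0; apply: mulr_ge0 => //.
  by apply: mulr_ge0; [exact: powR_ge0|exact: phi0].
by apply: mulr_ge0 => //; exact: powR_ge0.
Qed.

Let time_bound z : Q z -> `|u z * dt phi z| <= Bd z.
Proof.
move=> Qz; have /andP[t0 t1] := theta01 Qz; have /andP[c0 c1] := cutoff01 z.2.
rewrite dt_test_fun.
set th := 1 - z.1 / T in t0 t1 *; set ps := cutoff r z.2 in c0 c1 *.
have kT : 0 <= k.+3%:R / T by rewrite divr_ge0// ltW.
(* This is where [T = r^(2s)] is used: the time derivative and the
   fractional Laplacian have the same size. *)
have kM : k.+3%:R / T <= M.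
  by rewrite /M TE -powRN -mulrA ler_wpM2l// ler_peMl ?powR_ge0// lerDl.
have tp0 : 0 <= k.+3%:R / T * th ^+ k.+2 * ps ^+ k.+3.
  by apply: mulr_ge0; [apply: mulr_ge0 => //|]; exact: exprn_ge0.
rewrite mulNr mulNr mulrN normrN normrM (ger0_norm tp0).
have qk' : q <= k.+1.+2%:R by [].
have Y := young_weight young K0 (normr_ge0 (u z)) M0 (_ : 0 <= th <= 1) qk'.
have {}Y := Y (introT andP (conj t0 t1)).
apply: (@le_trans _ _ ((`|u z| * M * th ^+ k.+2) * ps ^+ k.+3)).
  move: (k.+3%:R / T) kM => c cM.
  rewrite (mulrA _ (c * _)) (mulrA _ c) ler_wpM2r ?exprn_ge0//.
  by rewrite ler_wpM2r ?exprn_ge0// ler_wpM2l.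
apply: (@le_trans _ _ ((4^-1 * `|u z| `^ p * th ^+ k.+3 + K * M `^ q) * ps ^+ k.+3)).
  by rewrite ler_wpM2r ?exprn_ge0.
rewrite mulrDl /Bd /test_fun -/th -/ps; apply: lerD; first by rewrite -!mulrA.
apply: ler_wpM2l; first by rewrite mulr_ge0 ?powR_ge0.
exact: cutoffX_le_gauss.
Qed.

Let space_bound z : Q z -> 0 <= u z ->
  u z * ((1 - z.1 / T) ^+ k.+3 * g0 z.2) <= Bd z.
Proof.
move=> Qz uz; have /andP[t0 t1] := theta01 Qz; have /andP[c0 c1] := cutoff01 z.2.
set th := 1 - z.1 / T in t0 t1 *.
have th0 : 0 <= th ^+ k.+3 by exact: exprn_ge0.
have th1 : th ^+ k.+3 <= 1 by exact: exprn_ile1.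
apply: (le_trans (ler_wpM2l uz (ler_wpM2l th0 (g0_le z.2)))).
(* Inside the ball the Gaussian is at least 1, which bounds the remainder of
   [young_weight] at points where the cutoff carries no spare power. *)
have [xr|xr] := leP (enorm z.2) r; last first.
  by rewrite cutoff_outside// expr0n /= !(mulr0, mul0r); exact: Bd_ge0.
set ps := cutoff r z.2 in c0 c1 *.
have qk' : q <= k.+1.+2%:R by [].
have Y := young_weight young K0 uz M0 (_ : 0 <= ps <= 1) qk'.
have {}Y := Y (introT andP (conj c0 c1)).
have kM : k.+3%:R * (C * r `^ (- (2 * s))) <= M.
  by rewrite /M -!mulrA ler_wpM2l// ler_wpM2r ?powR_ge0// lerDr.
apply: (@le_trans _ _ (th ^+ k.+3 * (u z * M * ps ^+ k.+2))).
  rewrite mulrCA ler_wpM2l//.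
  by rewrite [_ * ps ^+ _ * _]mulrAC mulrA ler_wpM2r ?exprn_ge0// ler_wpM2l.
apply: (le_trans (ler_wpM2l th0 Y)).
rewrite /Bd mulrDr (ger0_norm uz) lerD//.
  rewrite le_eqVlt; apply/orP; left; apply/eqP.
  by rewrite /test_fun -/th -/ps; ring.
apply: (@le_trans _ _ (K * M `^ q)).
  by rewrite ler_piMl// mulr_ge0 ?powR_ge0.
rewrite ler_peMr ?mulr_ge0 ?powR_ge0//.
exact: (gauss_scaled_ge1 r0 xr).
Qed.

(** With [X] the integral of [|u|^p phi], each of the two terms on the right of
    the weak formulation is at most [X / 4 + D]. Since [X] is finite, by the local
    integrability of [|u|^p], the inequality [X + W <= X / 2 + 2 D] gives
    [W <= 2 D]. *)
Lemma integral_source_le : (W <= (2 * D)%:E)%E.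
Proof.
have [_ ae_u _ weak] := wsol.
have := weak T phi _ T0 (admissible_test_fun r0 T0 fg0).
set U0 := (\int[leb R n]_x _)%E.
(* [u0] is nonnegative only almost everywhere; its positive part has the
   same integral. *)
have U0_ge0 : (0 <= U0)%E.
  have mphi0 : measurable_fun setT (fun x : 'rV[R]_n => phi (0, x)).
    rewrite /test_fun /=; apply: measurable_funM; apply: measurable_funX.
      exact: measurable_cst.
    exact: measurable_cutoff.
  have -> : U0 = (\int[leb R n]_x (Num.max 0 (u0 x) * phi (0, x))%:E)%E.
    apply: ae_eq_integral => //.
    - by apply/measurable_EFinP; exact: measurable_funM.
    - by apply/measurable_EFinP; apply: measurable_funM => //; exact: measurable_maxr.
    - by apply: filterS u00 => x ux _; rewrite (max_idPr ux).
  apply: integral_ge0 => x _; rewrite lee_fin mulr_ge0 ?le_max ?lexx//.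
  by apply: test_fun_ge0 => //; rewrite lexx ltW.
have -> : (\int[lebtx R n]_(z in Q) ((`|u z| `^ p + w z) * phi z)%:E = X + W)%E.
  rewrite -ge0_integralD//; last 2 first.
  - by move=> z Qz; rewrite lee_fin mulr_ge0 ?powR_ge0 ?phi0.
  - by move=> z Qz; rewrite lee_fin mulr_ge0 ?phi0// le_max lexx.
  apply: ae_eq_integral => //.
  - by apply/measurable_EFinP; apply: measurable_funM => //; exact: measurable_funD.
  - exact: emeasurable_funD.
  - apply: (@filterS _ _ (ae_filter_ringOfSetsType (lebtx R n)) _ _ _ w0) => z wz Qz; rewrite mulrDl EFinD (max_idPr _)//.
    by apply: wz; case: Qz => /=; rewrite in_itv/= => /andP[/ltW].
move=> E.
have H3 : (- (\int[lebtx R n]_(z in Q) (u z * dt phi z)%:E) <=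
    \int[lebtx R n]_(z in Q) (Bd z)%:E)%E.
  apply: integral_oppr_le => //.
  - apply/measurable_EFinP; apply: measurable_funM => //.
    rewrite (_ : dt phi = fun z => - (k.+3%:R / T) * (1 - z.1 / T) ^+ k.+2 *
        cutoff r z.2 ^+ k.+3); last by apply/funext => z; exact: dt_test_fun.
    apply: measurable_funTS; apply: measurable_funM; last first.
      by apply: measurable_funX; exact: (measurableT_comp (@measurable_cutoff R n r) measurable_snd).
    apply: measurable_funM => //; apply: measurable_funX; apply: measurable_funB => //.
    by apply: measurable_funM => //; exact: measurable_fst.
have H4 : (\int[lebtx R n]_(z in Q) (u z * ((1 - z.1 / T) ^+ k.+3 * g0 z.2))%:E <=
    \int[lebtx R n]_(z in Q) (Bd z)%:E)%E.
  have [_ /integrableP[/measurable_EFinP mg0 _] _] := fg0.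
  apply: ae_integral_le => //.
  - apply/measurable_EFinP; apply: measurable_funM => //; apply: measurable_funTS.
    apply: measurable_funM; last exact: (measurableT_comp mg0 measurable_snd).
    apply: measurable_funX; apply: measurable_funB => //.
    by apply: measurable_funM => //; exact: measurable_fst.
  - apply: (@filterS _ _ (ae_filter_ringOfSetsType (lebtx R n)) _ _ _ ae_u) => z uz Qz; rewrite lee_fin; apply: space_bound => //.
    by apply: uz; case: Qz => /=; rewrite in_itv/= => /andP[/ltW].
have : (X + W <= (4^-1%:E * X + D%:E) + (4^-1%:E * X + D%:E))%E.
  rewrite -integral_Bd; apply: le_trans (leeD H3 H4).
  by rewrite -E leeDl.
have Xfin : X \is a fin_num by rewrite ge0_fin_numE.
rewrite -(fineK Xfin) -!EFinM -!EFinD.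
have := fine_ge0 X_ge0.
move: W_ge0; case: W => [w'| |]//= _ x0.
by rewrite -EFinD !lee_fin; lra.
Qed.

End a_priori_bound.

(** * Lower bound on the source *)

(** Tonelli's theorem, after restricting to the slab [a <= t <= b]. *)
Lemma integral_slab_ge (R : realType) (n : nat) (a b T A : R)
    (f : measurableTypeR R * 'rV[R]_n -> \bar R) :
  0 < a -> a <= b -> b < T ->
  measurable_fun (cyl n `]0, T[) f ->
  (forall z, cyl n `]0, T[ z -> (0 <= f z)%E) ->
  (forall t, a <= t <= b -> (A%:E <= \int[leb R n]_x f (t, x))%E) ->
  0 <= A ->
  ((A * (b - a))%:E <= \int[lebtx R n]_(z in cyl n `]0%R, T[) f z)%E.
Proof.
move=> a0 ab bT mf f0 fA A0; rewrite integral_mkcond.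
have mF : measurable_fun setT (f \_ (cyl n `]0, T[)).
  by apply/(measurable_restrictT _ _).1 => //; exact: measurable_cyl.
have F0 z : (0 <= (f \_ (cyl n `]0%R, T[)) z)%E by exact: erestrict_ge0.
rewrite /lebtx fubini_tonelli1; [|exact: mF|exact: F0].
have mI := @measurable_fun_fubini_tonelli_F _ _ _ _ R (leb R n) _ mF F0.
set I := fubini_F _ _ in mI *.
have I0 t : (0 <= I t)%E by apply: integral_ge0 => x _; exact: F0.
apply: (@le_trans _ _ (\int[lebesgue_measure]_(t in `[a, b]) I t)%E); last first.
  by apply: ge0_subset_integral => //; exact: measurable_itv.
apply: (@le_trans _ _ (\int[lebesgue_measure]_(t in `[a, b]) A%:E)%E).
  have lab : lebesgue_measure `[a, b]%classic = (b - a)%:E.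
    rewrite lebesgue_measure_itv/= lte_fin; case: ltP => // ba.
    by rewrite (le_anti (introT andP (conj ab ba))) subrr.
  by rewrite integral_cst ?[X in (_ * X)%E]lab -?EFinM//; exact: measurable_itv.
apply: ge0_le_integral => //.
- exact: measurable_funTS.
- move=> t; rewrite /= in_itv/= => tab; apply: (le_trans (fA t tab)).
  rewrite le_eqVlt; apply/orP; left; apply/eqP.
  apply: eq_integral => x _; rewrite patchE mem_set//; split => //=.
  rewrite in_itv/=; case/andP: tab => a_t tb.
  by rewrite (lt_le_trans a0 a_t) (le_lt_trans tb bT).
Qed.

Lemma measurable_section (R : realType) (n : nat) (w : R * 'rV[R]_n -> R) (t : R) :
  measurable_fun (cyl n `[0, +oo[) w -> 0 <= t ->
  measurable_fun setT (fun x : 'rV[R]_n => w (t, x)).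
Proof.
move=> mw t0.
have mW : measurable_fun setT (w \_ (cyl n `[0, +oo[)).
  by apply/(measurable_restrictT _ _).1 => //; exact: measurable_cyl.
have := measurableT_comp mW (@measurable_pair1 _ _ (measurableTypeR R) _ t).
apply: eq_measurable_fun => x _ /=; rewrite patchE mem_set//.
by split => //=; rewrite in_itv/= t0.
Qed.

Section source_lower_bound.
Variables (R : realType) (n : nat) (m gamma c0 : R) (w : R * 'rV[R]_n -> R).
Hypothesis c0_gt0 : 0 < c0.
Hypothesis mw : measurable_fun (cyl n `[0, +oo[) w.
Hypothesis w_ge : forall t r : R, 1 <= t -> 1 <= r ->
  ((c0 * t `^ m * r `^ gamma)%:E
    <= \int[leb R n]_(x in eball n r) (w (t, x))%:E)%E.

(** For [t <= T / 2] and [|x| <= r / 2] both bases of the test function are at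
    least 1/2, so that it is at least [4^(-k-3)] on the ball of radius [r / 2].
    The positive part of [w] is used because [w] is nonnegative only almost
    everywhere, which says nothing about an individual time slice. *)
Lemma integral_section_ge (r T t : R) (k : nat) :
  2 <= r -> 4 <= T -> T / 4 <= t <= T / 2 ->
  ((4^-1 ^+ k.+3 * (c0 * (4 `^ (- `|m|) * T `^ m) * (r / 2) `^ gamma))%:E <=
   \int[leb R n]_x (Num.max 0 (w (t, x)) * test_fun r T k (t, x))%:E)%E.
Proof.
move=> r2 T4 /andP[tT tT2].
have r0 : 0 < r by lra.
have T0 : 0 < T by lra.
have t1 : 1 <= t by lra.
have mws : measurable_fun setT (fun x : 'rV[R]_n => Num.max 0 (w (t, x))).
  by apply: measurable_maxr => //; apply: measurable_section => //; lra.
have mphi : measurable_fun setT (fun x : 'rV[R]_n => test_fun r T k (t, x)).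
  exact: (measurableT_comp (@measurable_test_fun R n r T k) (@measurable_pair1 _ _ (measurableTypeR R) _ t)).
have phi0 (x : 'rV[R]_n) : 0 <= test_fun r T k (t, x).
  by apply: test_fun_ge0 => //; apply/andP; split; lra.
have max0 (x : 'rV[R]_n) : 0 <= Num.max 0 (w (t, x)) by rewrite le_max lexx.
have mB := @measurable_eball R n (r / 2).
apply: (@le_trans _ _ ((4^-1 ^+ k.+3)%:E *
    \int[leb R n]_(x in eball n (r / 2)) (Num.max 0 (w (t, x)))%:E)%E).
  rewrite EFinM lee_wpmul2l//.
  apply: (@le_trans _ _ (c0 * t `^ m * (r / 2) `^ gamma)%:E).
    rewrite lee_fin ler_wpM2r ?powR_ge0// ler_wpM2l ?(ltW c0_gt0)//.
    by apply: powR_quarter_le => //; apply/andP; split; lra.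
  apply: (le_trans (w_ge t1 _)); first by lra.
  apply: ae_integral_le => //.
  - by apply: measurable_funTS; apply/measurable_EFinP; apply: measurable_section => //; lra.
  - by apply: measurable_funTS; apply/measurable_EFinP.
  - by move=> x _; rewrite lee_fin.
  - by apply: aeW => x _; rewrite lee_fin le_max lexx orbT.
rewrite -ge0_integralZl//; last 2 first.
- by apply: measurable_funTS; apply/measurable_EFinP.
- by move=> x _; rewrite lee_fin.
have mprod : measurable_fun setT
    (fun x : 'rV[R]_n => (Num.max 0 (w (t, x)) * test_fun r T k (t, x))%:E).
  by apply/measurable_EFinP; exact: measurable_funM.
apply: (@le_trans _ _ (\int[leb R n]_(x in eball n (r / 2))
    (Num.max 0 (w (t, x)) * test_fun r T k (t, x))%:E)%E); last first.
  by apply: ge0_subset_integral => // x _; rewrite lee_fin mulr_ge0.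
apply: ge0_le_integral => //.
- by move=> x _; rewrite -EFinM lee_fin mulr_ge0 ?exprn_ge0.
- by apply: measurable_funTS; apply/measurable_EFinP; exact: measurable_funM.
- exact: measurable_funTS.
- move=> x xr; rewrite -EFinM lee_fin mulrC ler_wpM2l// /test_fun -exprMn.
  apply: lerXn2r; rewrite ?nnegrE//.
    apply: mulr_ge0; last exact: cutoff_ge0.
    by rewrite subr_ge0 ler_pdivrMr//=; lra.
  have -> : 4^-1 = 2^-1 * 2^-1 :> R by rewrite -invfM; congr (_^-1); ring.
  apply: ler_pM => //; last exact: cutoff_half.
  have : t / T <= 2^-1 by rewrite ler_pdivrMr//; lra.
  by move=> /=; lra.
Qed.

(** The slab [T / 4 <= t <= T / 2] has length [T / 4] and lies in [t >= 1] as
    soon as [4 <= T]. *)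
Lemma integral_source_ge (r T : R) (k : nat) : 2 <= r -> 4 <= T ->
  ((4^-1 ^+ k.+3 * (c0 * (4 `^ (- `|m|) * T `^ m) * (r / 2) `^ gamma) * (T / 4))%:E <=
   \int[lebtx R n]_(z in cyl n `]0%R, T[) (Num.max 0 (w z) * test_fun r T k z)%:E)%E.
Proof.
move=> r2 T4.
have T0 : 0 < T by lra.
have -> : T / 4 = T / 2 - T / 4 by field.
apply: integral_slab_ge.
- by lra.
- by lra.
- by lra.
- apply/measurable_EFinP; apply: measurable_funM.
    apply: measurable_maxr => //; apply: (measurable_funS _ _ mw).
      exact: measurable_cyl.
    move=> z [] /=; rewrite in_itv/= => /andP[/ltW t0 _] _.
    by split => //=; rewrite in_itv/= t0.
  by apply: measurable_funTS; exact: measurable_test_fun.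
- move=> [t x] [] /=; rewrite in_itv/= => /andP[t0 tT] _.
  rewrite lee_fin mulr_ge0 ?le_max ?lexx// test_fun_ge0//.
  by rewrite !ltW.
- by move=> t tT; exact: integral_section_ge.
- apply: mulr_ge0; first by rewrite exprn_ge0.
  rewrite mulr_ge0 ?powR_ge0// mulr_ge0 ?(ltW c0_gt0)//.
  by rewrite mulr_ge0 ?powR_ge0.
Qed.

End source_lower_bound.

(** * Nonexistence below the critical exponent *)

(** [d / (d - 2s)] is the exponent whose conjugate is [d / (2s)]. When
    [d <= 2s] it suffices that the conjugate exponent exceeds 1. *)
Lemma subcritical_exponent (R : realType) (s d p : R) : 0 < s -> 1 < p ->
  d <= 2 * s \/ p < d / (d - 2 * s) -> d < 2 * s * (p / (p - 1)).
Proof.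
move=> s0 p1 H.
have pm : 0 < p - 1 by lra.
rewrite mulrA ltr_pdivlMr//.
have [ds|ds] := leP d (2 * s); first by nra.
case: H => [|]; first by rewrite leNgt ds.
by rewrite ltr_pdivlMr ?subr_gt0//; lra.
Qed.

(** Both bounds on the integral of the source are powers of [r]; the strict
    inequality between the exponents contradicts them for large [r]. *)
Lemma no_global_weak_solution (R : realType) (N : nat) (s m gamma : R)
    (w : R * 'rV[R]_N -> R) (c0 p : R) :
  0 < s < 1 ->
  Lploctx 1 w ->
  {ae lebtx R N, forall z, 0 <= z.1 -> 0 <= w z} ->
  0 < c0 ->
  (forall t r : R, 1 <= t -> 1 <= r ->
    ((c0 * t `^ m * r `^ gamma)%:E
      <= \int[leb R N]_(x in eball N r) (w (t, x))%:E)%E) ->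
  1 < p -> N%:R - gamma - 2 * s * m < 2 * s * (p / (p - 1)) ->
  ~ has_global_weak_solution s p w.
Proof.
move=> s01 [mw _] w0 c0_gt0 w_ge p1 crit [u0 [u [[mu0 _] u00 wsol]]].
have s0 : 0 < s by case/andP: s01.
have [K K0 young] := @young_quarter R p _ p1 erefl.
have [C C0 Hg] := fraclap_cutoff N s01.
set q := p / (p - 1) in crit young.
(* [k.+3 >= q], as [young_weight] requires. *)
pose k := Num.truncn q.
have qk : q <= k.+3%:R.
  by apply: ltW; apply: (lt_trans (truncnS_gt q)); rewrite ltr_nat.
pose L := k.+3%:R * (1 + C).
have L0 : 0 <= L by rewrite mulr_ge0// addr_ge0.
pose A := 4^-1 ^+ k.+3 * (c0 * 4 `^ (- `|m|) * 2^-1 `^ gamma) / 4.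
pose B := 2 * (K * L `^ q * (expR 1 * Num.sqrt pi ^+ N)).
have A0 : 0 < A.
  apply: divr_gt0 => //; apply: mulr_gt0; first by rewrite exprn_gt0 ?invr_gt0.
  apply: mulr_gt0; last by rewrite powR_gt0 ?invr_gt0.
  by rewrite mulr_gt0 ?powR_gt0.
(* [r >= 4^(1/(2s))] ensures [T >= 4], and [r >= 2] that the half ball has
   radius at least 1. *)
apply: (@powR_dominates R (2 * s * (1 + m) + gamma)
  (2 * s * (1 - q) + N%:R) A B (Num.max 2 (4 `^ (2 * s)^-1))) => //.
  by nra.
move=> r; rewrite ge_max => /andP[r2 r4] r1.
have r0 : 0 < r by lra.
have T4 : 4 <= r `^ (2 * s).
  have : 4 `^ (2 * s)^-1 `^ (2 * s) <= r `^ (2 * s).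
    by apply: ge0_ler_powR => //; rewrite ?nnegrE ?powR_ge0 ?(ltW r0)//; lra.
  by rewrite -powRrM mulVf ?powRr1// gt_eqF//; lra.
have [g fg g_le] := Hg k.+1 r r0.
have := le_trans (integral_source_ge c0_gt0 mw w_ge k r2 T4)
  (integral_source_le mw w0 mu0 u00 wsol K0 C0 qk young r0 erefl fg g_le).
rewrite lee_fin.
suff [-> ->] : 4^-1 ^+ k.+3 * (c0 * (4 `^ (- `|m|) * (r `^ (2 * s)) `^ m) *
    (r / 2) `^ gamma) * (r `^ (2 * s) / 4) = A * r `^ (2 * s * (1 + m) + gamma) /\
  2 * (K * (L * r `^ (- (2 * s))) `^ q * (r `^ (2 * s) *
    (expR 1 * (r * Num.sqrt pi) ^+ N))) = B * r `^ (2 * s * (1 - q) + N%:R) by [].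
have rD a b : r `^ (a + b) = r `^ a * r `^ b by rewrite powRD// (gt_eqF r0) implybT.
split.
  have -> : 2 * s * (1 + m) + gamma = 2 * s + (2 * s * m + gamma) by ring.
  rewrite !rD powRM ?invr_ge0 ?(ltW r0)// -powRrM /A.
  by move: (r `^ (2 * s)) (r `^ _) (r `^ gamma) (2^-1 `^ _) (4 `^ _) (_ ^+ _) => *; ring.
have -> : 2 * s * (1 - q) + N%:R = - (2 * s) * q + (2 * s + N%:R) by ring.
rewrite !rD powRM ?powR_ge0// -powRrM powR_mulrn ?(ltW r0)// exprMn /B.
by move: (r `^ (2 * s)) (r `^ _) (r ^+ N) (L `^ _) (expR _) (_ ^+ _) => *; ring.
Qed.

Theorem theorem8p4 (R : realType) (N : nat) (s m gamma : R)
    (w : R * 'rV[R]_N -> R) (c0 : R) :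
  0 < s < 1 -> (1 <= N)%N -> -1 < m -> 0 <= gamma ->
  Lploctx 1 w ->
  {ae lebtx R N, forall z, 0 <= z.1 -> 0 <= w z} ->
  0 < c0 ->
  (forall t r : R, 1 <= t -> 1 <= r ->
    ((c0 * t `^ m * r `^ gamma)%:E
      <= \int[leb R N]_(x in eball N r) (w (t, x))%:E)%E) ->
  (forall p : R, 1 < p -> (p%:E < fujita_exponent N s gamma m)%E ->
    ~ has_global_weak_solution s p w) /\
  (N%:R - gamma - 2 * s * m <= 2 * s ->
    forall p : R, 1 < p -> ~ has_global_weak_solution s p w).
Proof.
move=> s01 _ _ _ Lw w0 c0_gt0 w_ge.
have s0 : 0 < s by case/andP: s01.
have main (p : R) : 1 < p -> N%:R - gamma - 2 * s * m <= 2 * s \/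
    p < (N%:R - gamma - 2 * s * m) / (N%:R - gamma - 2 * s * m - 2 * s) ->
    ~ has_global_weak_solution s p w.
  move=> p1 H; apply: (no_global_weak_solution s01 Lw w0 c0_gt0 w_ge p1).
  exact: subcritical_exponent.
split=> [p p1|d p p1]; last by apply: main => //; left.
rewrite /fujita_exponent; case: ifPn => d; first by move=> _; apply: main => //; left.
by rewrite lte_fin => pd; apply: main => //; right.
Qed.
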